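(* Let $(\mathcal D_n)_{n\ge1}$ be a sequence of decorations and $\mathcal D_\infty$ a decoration such that for every $u\in\mathbb U$, $\mathcal D_n(u)\to\mathcal D_\infty(u)$ as $n\to\infty$ in the infinitely pointed Gromov–Hausdorff topology, and such that the real-valued decoration $\ell:u\mapsto\sup_{n\ge1}\operatorname{diam}(\mathcal D_n(u))$ is non-explosive. Then: (i) $\mathscr G(\mathcal D_n)\to\mathscr G(\mathcal D_\infty)$ as $n\to\infty$ in the Gromov–Hausdorff topology. (ii) Suppose furthermore that for all $n\ge1$ we have a family $\boldsymbol\nu_n=(\nu_{u,n})_{u\in\mathbb U}$, where $\nu_{u,n}$ is a Borel measure on the block $\mathcal D_n(u)$, such that the corresponding measures $\nu_n$ on $\mathbb U$ (that is, $\nu_n(\{u\})$ is the total mass of $\nu_{u,n}$) are probability measures and converge weakly on $\overline{\mathbb U}$ as $n\to\infty$ to a probability measure $\nu_\infty$ that only charges $\partial\mathbb U$. Then $$\mathscr G(\mathcal D_n,\boldsymbol\nu_n)\longrightarrow\mathscr G(\mathcal D_\infty,\nu_\infty)\quad\text{as }n\to\infty$$ in the Gromov–Hausdorff–Prokhorov topology.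
   Context: **Ulam tree.** $\mathbb N=\{1,2,\dots\}$; $\mathbb U=\bigcup_{n\ge0}\mathbb N^n$ is the set of finite words, $\partial\mathbb U=\mathbb N^{\mathbb N}$, $\overline{\mathbb U}=\mathbb U\cup\partial\mathbb U$. Write $u\preceq v$ if $u$ is a prefix of $v$ ($\prec$ if strict), $u\wedge v$ for the longest common prefix, $T(u)=\{v\in\overline{\mathbb U}:u\preceq v\}$. $\overline{\mathbb U}$ carries the (Polish) topology generated by the sets $T(u)$ and $\{u\}$, $u\in\mathbb U$. A plane tree is a finite non-empty $\tau\subset\mathbb U$ such that the parent $u$ of any $ui\in\tau$ is in $\tau$, and for each $u\in\tau$ there is an integer $\deg^+_\tau(u)\ge0$ with $ui\in\tau$ iff $i\le\deg^+_\tau(u)$. **Non-explosion.** A function $\ell:\mathbb U\to\mathbb R_+$ is non-explosive if $\inf_{\theta}\sup_{u\in\mathbb U}\sum_{v\preceq u,\,v\notin\theta}\ell(v)=0$, where the infimum is over all finite plane trees $\theta$. **Pointed spaces.** $\mathbb M^{\infty\bullet}$ is the set of isometry classes of non-empty compact metric spaces $(X,d,\rho_0,(\rho_i)_{i\ge1})$ with a root $\rho_0$ and a sequence of distinguished points. For $k\ge0$, $\mathrm d_{\mathrm{GH}}^{(k)}(X,X')$ is the infimum, over isometric embeddings $\phi,\phi'$ of $X,X'$ into a common metric space, of the maximum of the Hausdorff distance between $\phi(X)$ and $\phi'(X')$ and of $\max_{0\le i\le k}\delta(\phi(\rho_i),\phi'(\rho_i'))$, where $\delta$ is the metric of the common space.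 The infinitely pointed Gromov–Hausdorff topology is that of $\mathrm d_{\mathrm{GH}}^{(\infty)}=\sum_{k\ge1}2^{-k}\mathrm d^{(k)}_{\mathrm{GH}}$. **Decorations and gluing.** A decoration is a map $\mathcal D:\mathbb U\to\mathbb M^{\infty\bullet}$, $\mathcal D(u)=(D_u,d_u,\rho_u,(x_{ui})_{i\ge1})$; $\mathcal D(u)$ is called a block. $\mathscr G^*(\mathcal D)$ is the disjoint union $\bigsqcup_{u\in\mathbb U}D_u$ with each root $\rho_{ui}\in D_{ui}$ identified with $x_{ui}\in D_u$, with the gluing metric: for $y\in D_u$ and $w\preceq u$ let $\pi_w(y)=y$ if $w=u$ and $\pi_w(y)=x_{wi}$ if $wi\preceq u$; then for $y\in D_u$, $z\in D_v$, $w=u\wedge v$, $$\mathrm d(y,z)=d_w(\pi_w(y),\pi_w(z))+\sum_{w\prec w'\preceq u}d_{w'}(\rho_{w'},\pi_{w'}(y))+\sum_{w\prec w'\preceq v}d_{w'}(\rho_{w'},\pi_{w'}(z)).$$ $\mathscr G(\mathcal D)$ is the metric completion of $\mathscr G^*(\mathcal D)$. If $u\mapsto\operatorname{diam}(D_u)$ is non-explosive then $\mathscr G(\mathcal D)$ is compact. **Measures.** For a family $\boldsymbol\nu=(\nu_u)_{u\in\mathbb U}$ of Borel measures on the blocks, $\mathscr G(\mathcal D,\boldsymbol\nu)$ is $\mathscr G(\mathcal D)$ endowed with $\sum_u\nu_u$ (each block being viewed inside $\mathscr G(\mathcal D)$). For a measure $\mu$ on $\partial\mathbb U$ (with $\mathscr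 G(\mathcal D)$ compact), $\mathscr G(\mathcal D,\mu)=(\mathscr G(\mathcal D),(\iota_{\mathcal D})_*\mu)$, where $\iota_{\mathcal D}:\partial\mathbb U\to\mathscr G(\mathcal D)$ is the continuous map $\iota_{\mathcal D}(i_1i_2\cdots)=\lim_{n\to\infty}x_{i_1\cdots i_n}$. *)

(* Defs.v *)
From HB Require Import structures.
From Stdlib Require Import Relation_Operators.
From mathcomp Require Import all_boot all_order all_algebra.
From mathcomp Require Import all_classical all_reals all_analysis.
From mathcomp Require Import lra.

Set Implicit Arguments.
Unset Strict Implicit.
Unset Printing Implicit Defensive.

Import Order.TTheory GRing.Theory Num.Def Num.Theory.
Import numFieldNormedType.Exports.

Local Open Scope classical_set_scope.
Local Open Scope ring_scope.

(** * The Ulam tree *)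

(* The letter i : nat stands for the positive integer i + 1, so that the
   children of u are the words rcons u 0, rcons u 1, etc. *)
Notation word := (seq nat).

Fixpoint lcp (u v : word) : word :=
  match u, v with
  | a :: u', b :: v' => if a == b then a :: lcp u' v' else [::]
  | _, _ => [::]
  end.

(* Ray x is the infinite word x 0, x 1, etc. *)
Inductive ulam_bar : Type := Word of word | Ray of (nat -> nat).

HB.instance Definition _ := gen_eqMixin ulam_bar.
HB.instance Definition _ := gen_choiceMixin ulam_bar.
HB.instance Definition _ := isPointed.Build ulam_bar (Word [::]).

Definition cone (u : word) : set ulam_bar :=
  [set v | match v with
           | Word w => prefix u w
           | Ray x => mkseq x (size u) = u
           end].

HB.instance Definition _ := isSubBaseTopological.Build ulam_bar
  [set A | exists u, A = cone u \/ A = [set Word u]] id.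

Lemma cone_prefix u v p : cone u p -> cone v p -> (size u <= size v)%N ->
  cone v `<=` cone u.
Proof.
have aux x k l : (k <= l)%N -> take k (mkseq x l) = mkseq x k :> word.
  by move=> kl; rewrite /mkseq -map_take take_iota (minn_idPl kl).
move=> up vp uv; have uvp : prefix u v.
  case: p up vp => [w|x] /= up vp.
    move: up vp; rewrite [prefix u w]prefixE [prefix v w]prefixE.
    by move=> /eqP uw /eqP vw; rewrite prefixE -vw take_takel // uw.
  by rewrite prefixE -vp aux // up.
case=> [w|x] /=; first exact: prefix_trans.
move=> vx; move: uvp; rewrite prefixE -vx aux ?size_mkseq; last first.
  by rewrite -(size_mkseq x (size v)) vx.
by move=> /eqP.
Qed.

Local Definition ulam_base : set (set ulam_bar) :=
  [set A | exists u, A = cone u \/ A = [set Word u]].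

Local Lemma ulam_base_open (B : set ulam_bar) : ulam_base B -> open B.
Proof.
move=> bB; exists [set B]; last by rewrite bigcup_set1.
move=> _ ->; exists (finmap.fset1 B); last first.
  by rewrite set_fset1 bigcap_set1.
by move=> i; rewrite finmap.inE => /eqP ->; rewrite inE.
Qed.

Lemma open_cone u : open (cone u).
Proof. by apply: ulam_base_open; exists u; left. Qed.

Lemma open_Word u : open [set Word u].
Proof. by apply: ulam_base_open; exists u; right. Qed.

Local Lemma ulam_base_seq (s : seq (set ulam_bar)) p :
  ~ (exists u, p = Word u) -> (forall i, i \in s -> ulam_base i /\ i p) ->
  exists u, cone u p /\ forall i, i \in s -> cone u `<=` i.
Proof.
move=> nW; elim: s => [|C s IHs] Ep.
  by exists [::]; split => //; case: p {nW Ep} => // w; exact: prefix0s.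
have [|u [up us]] := IHs.
  by move=> i si; apply: Ep; rewrite in_cons si orbT.
have [[v [Cv|Cv]] Cp] := Ep C (mem_head _ _); last first.
  by exfalso; apply: nW; exists v; rewrite Cv in Cp.
rewrite Cv in Cp.
have [uv|/ltnW vu] := leqP (size u) (size v).
  exists v; split => // i; rewrite in_cons => /orP[/eqP -> |si].
    by rewrite Cv.
  by apply: subset_trans (us _ si); exact: (cone_prefix up Cp).
exists u; split => // i; rewrite in_cons => /orP[/eqP -> |si]; last exact: us.
by rewrite Cv; exact: (cone_prefix Cp up).
Qed.

Lemma ulam_openP (A : set ulam_bar) : open A <->
  forall p, A p -> exists u,
    (cone u p /\ cone u `<=` A) \/ (p = Word u /\ A (Word u)).
Proof.
split; last first.
  move=> h.
  have -> : A = \bigcup_(B in [set B | ulam_base B /\ B `<=` A]) B.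
    apply/seteqP; split => [p Ap|p [B [_ BA] /BA]] //.
    have [u [[up uA]|[-> Au]]] := h _ Ap.
      by exists (cone u) => //; split => //; exists u; left.
    by exists [set Word u] => //; split; [exists u; right|move=> _ ->].
  by apply: bigcup_open => B [/ulam_base_open].
move=> [F FI <-] p [B FB Bp]; have [E Eb EB] := FI _ FB.
suff [u hu] : exists u,
    (cone u p /\ cone u `<=` B) \/ (p = Word u /\ B (Word u)).
  exists u; case: hu => [[up uB]|[pu Bu]].
    by left; split => // q /uB Bq; exists B.
  by right; split => //; exists B.
have [[u pu]|nW] := pselect (exists u, p = Word u).
  by exists u; right; split => //; rewrite -pu.
have [|u [up us]] := @ulam_base_seq (finmap.enum_fset E) p nW.
  move=> i iE; split; first by have := Eb _ iE; rewrite inE.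
  by move: Bp; rewrite -EB; apply; exact: iE.
exists u; left; split => // q uq; rewrite -EB => i iE; exact: us.
Qed.

Definition plane_tree (theta : set word) : Prop :=
  [/\ finite_set theta, theta !=set0,
      forall u i, theta (rcons u i) -> theta u &
      forall u, theta u ->
        exists deg : nat, forall i, theta (rcons u i) <-> (i < deg)%N].

(* The prefixes of u are the words take k u for 0 <= k <= size u. *)
Definition non_explosive (R : realType) (l : word -> R) : Prop :=
  ereal_inf [set ereal_sup [set (\sum_(k < (size u).+1 | take k u \notin theta)
                                   l (take k u))%:E | u in [set: word]]
            | theta in plane_tree] = 0%E.

(** * Metric spaces *)

#[short(type="pmetricType")]
HB.structure Definition PointedMetric (K : numDomainType) :=
  {M of Metric K M & isPointed M}.

Notation borel Z := (g_sigma_algebraType (@open Z)).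

Section metric_spaces.
Variable R : realType.

Definition isometric (X Y : pmetricType R) (f : X -> Y) : Prop :=
  forall x y, mdist (f x) (f y) = mdist x y.

(* A real number: only relevant for bounded spaces. *)
Definition diam (X : pmetricType R) : R :=
  sup [set mdist p.1 p.2 | p in [set: X * X]].

Definition hausdorff_dist (Z : pmetricType R) (A B : set Z) : \bar R :=
  maxe (ereal_sup [set ereal_inf [set (mdist a b)%:E | b in B] | a in A])
       (ereal_sup [set ereal_inf [set (mdist a b)%:E | a in A] | b in B]).

Definition thickening (Z : pmetricType R) (A : set Z) (e : R) : set Z :=
  [set z | exists2 a, A a & mdist a z < e].

(* Only the values of mu and nu on Borel sets matter. *)
Definition prokhorov_dist (Z : pmetricType R) (mu nu : set Z -> \bar R) :
    \bar R :=
  ereal_inf [set e%:E | e in [set e : R | 0 < e /\ forall A, closed A ->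
    (mu A <= nu (thickening A e) + e%:E)%E /\
    (nu A <= mu (thickening A e) + e%:E)%E]].

(* X and Y being non-empty, so is the common space Z. *)
Definition GH_dist (X Y : pmetricType R) : \bar R :=
  ereal_inf [set e | exists (Z : pmetricType R) (f : X -> Z) (g : Y -> Z),
    [/\ isometric f, isometric g &
        e = hausdorff_dist (range f) (range g)]].

Definition GHP_dist (X Y : pmetricType R)
    (mu : set (borel X) -> \bar R) (nu : set (borel Y) -> \bar R) : \bar R :=
  ereal_inf [set e | exists (Z : pmetricType R) (f : X -> Z) (g : Y -> Z),
    [/\ isometric f, isometric g &
        e = maxe (hausdorff_dist (range f) (range g))
                 (@prokhorov_dist Z
                    (@pushforward _ _ (borel X) (borel Z) _ mu f)
                    (@pushforward _ _ (borel Y) (borel Z) _ nu g))]].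

(* An infinitely pointed compact metric space: the root is the canonical point
   of the carrier, and marked i is the distinguished point rho_(i+1). *)
Record block := Block {
  carrier :> pmetricType R;
  block_compact : compact [set: carrier];
  marked : nat -> carrier }.

Definition root (X : block) : X := point.

(* rho X 0 is the root, rho X i for i >= 1 are the distinguished points. *)
Definition rho (X : block) (i : nat) : X :=
  if i is j.+1 then marked X j else root X.

Definition GH_dist_pt (k : nat) (X Y : block) : \bar R :=
  ereal_inf [set e | exists (Z : pmetricType R) (f : X -> Z) (g : Y -> Z),
    [/\ isometric f, isometric g &
        e = maxe (hausdorff_dist (range f) (range g))
                 (\big[maxe/0%E]_(i < k.+1)
                     (mdist (f (rho X i)) (g (rho Y i)))%:E)]].

Definition GH_dist_infty (X Y : block) : \bar R :=
  (\sum_(1 <= k <oo) (2 ^- k)%:E * GH_dist_pt k X Y)%E.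

End metric_spaces.

(** * Metric completion *)

(* A point p of the completion of M is coded by the function d(p, .) on M; the
   functions so obtained are the uniform limits of the functions d(x, .), with
   x in M, and d(p, q) is the uniform distance between the functions d(p, .)
   and d(q, .).  The lemmas below show that this is a complete metric space in
   which M embeds isometrically with dense image. *)
Record completion (R : realType) (M : pmetricType R) := Completion {
  cdist : M -> R;
  cdistP : forall e, 0 < e -> exists x, forall y, `|cdist y - mdist x y| <= e }.

HB.instance Definition _ (R : realType) (M : pmetricType R) :=
  gen_eqMixin (completion M).
HB.instance Definition _ (R : realType) (M : pmetricType R) :=
  gen_choiceMixin (completion M).

Section completion.
Variables (R : realType) (M : pmetricType R).
Implicit Types (p q r : completion M).

Lemma completion_inj p q : cdist p =1 cdist q -> p = q.
Proof.
case: p q => f fP [g gP] /= /funext fg.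
by subst g; congr Completion; apply: Prop_irrelevance.
Qed.

Local Lemma to_completion_subproof (x : M) e : 0 < e ->
  exists z : M, forall y, `|mdist x y - mdist z y| <= e.
Proof. by move=> e0; exists x => y; rewrite subrr normr0 ltW. Qed.

Definition to_completion (x : M) : completion M :=
  Completion (@to_completion_subproof x).

HB.instance Definition _ :=
  isPointed.Build (completion M) (to_completion point).

Definition completion_dist p q : R :=
  sup [set `|cdist p y - cdist q y| | y in [set: M]].

Local Lemma ler_mdistD (x z y : M) : `|mdist x y - mdist z y| <= mdist x z.
Proof.
have := metric_triangle x z y; have := metric_triangle z x y.
by rewrite (metric_sym z x) ler_norml => ? ?; apply/andP; split; lra.
Qed.

Local Lemma has_sup_dist p q : 
  has_sup [set `|cdist p y - cdist q y| | y in [set: M]].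
Proof.
split; first by exists `|cdist p point - cdist q point|; exists point.
have [x px] := @cdistP _ _ p 1 ltr01; have [z qz] := @cdistP _ _ q 1 ltr01.
exists (1 + mdist x z + 1) => _ [y _ <-].
have -> : cdist p y - cdist q y =
  (cdist p y - mdist x y) + (mdist x y - mdist z y) + (mdist z y - cdist q y).
  by lra.
apply: (le_trans (ler_normD _ _)); apply: lerD; last by rewrite distrC qz.
by apply: (le_trans (ler_normD _ _)); rewrite lerD ?px ?ler_mdistD.
Qed.

Lemma le_completion_dist p q y : `|cdist p y - cdist q y| <= completion_dist p q.
Proof. by apply: ub_le_sup; [case: (has_sup_dist p q)|exists y]. Qed.

Lemma completion_dist_le p q (e : R) :
  (forall y, `|cdist p y - cdist q y| <= e) -> completion_dist p q <= e.
Proof.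
move=> h; apply: ge_sup; first by case: (has_sup_dist p q).
by move=> _ [y _ <-].
Qed.

Local Lemma completion_distxx p : completion_dist p p = 0.
Proof.
apply/le_anti/andP; split.
  by apply: completion_dist_le => y; rewrite subrr normr0.
by apply: le_trans (le_completion_dist p p point).
Qed.

Local Lemma completion_dist_eq0 p q : completion_dist p q = 0 -> p = q.
Proof.
move=> h; apply: completion_inj => y; apply/eqP.
by rewrite -subr_eq0 -normr_le0 -h le_completion_dist.
Qed.

Local Lemma completion_distC p q : completion_dist p q = completion_dist q p.
Proof.
by apply/le_anti/andP; split; apply: completion_dist_le => y; rewrite distrC;
  exact: le_completion_dist.
Qed.

Local Lemma completion_dist_triangle q p r :
  completion_dist p r <= completion_dist p q + completion_dist q r.
Proof.
apply: completion_dist_le => y.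
rewrite -(subrK (cdist q y) (cdist p y)) -addrA.
by apply: (le_trans (ler_normD _ _)); rewrite lerD ?le_completion_dist.
Qed.

HB.instance Definition _ := isMetric.Build R (completion M)
  completion_distxx completion_dist_eq0 completion_distC
  completion_dist_triangle.

Lemma to_completion_isometric : isometric to_completion.
Proof.
move=> x y; apply/le_anti/andP; split.
  by apply: completion_dist_le => z; exact: ler_mdistD.
have := le_completion_dist (to_completion x) (to_completion y) y.
by rewrite /= mdistxx subr0 ger0_norm ?mdist_ge0.
Qed.

Lemma to_completion_dense p (e : R) : 0 < e ->
  exists x : M, mdist p (to_completion x) < e.
Proof.
move=> e0; have [|x px] := @cdistP _ _ p (e / 2); first by rewrite divr_gt0.
exists x; apply: (@le_lt_trans _ _ (e / 2)); last by lra.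
exact: completion_dist_le.
Qed.

Local Lemma completion_complete (F : set_system (completion M)) :
  ProperFilter F -> cauchy F -> cvg F.
Proof.
move=> FF Fc; have /cauchyP Fex := Fc.
pose f y : R := lim ((fun q => cdist q y) @ F).
have fcvg y : (fun q => cdist q y) @ F --> f y.
  apply: cauchy_cvg; apply/cauchyP => e e0; have [p Fp] := Fex _ e0.
  exists (cdist p y); rewrite /fmap /=; apply: filterS Fp => q.
  rewrite ballEmdist /= => pq; rewrite /ball /=.
  exact: le_lt_trans (le_completion_dist p q y) pq.
have close (e : R) p : F (ball p e) -> forall y, `|f y - cdist p y| <= e.
  move=> Fp y; apply/ler_addgt0Pl => d d0.
  have /cvgrPdist_lt/(_ _ d0) Fy := fcvg y.
  have [q [/= fq pq]] := filter_ex (filterI Fy Fp).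
  rewrite -(subrK (cdist q y) (f y)) -addrA.
  apply: (le_trans (ler_normD _ _)); rewrite lerD ?(ltW fq)//.
  rewrite distrC; apply: (le_trans (le_completion_dist p q y)).
  by apply: ltW; move: pq; rewrite ballEmdist.
have fP (e : R) : 0 < e -> exists x, forall y, `|f y - mdist x y| <= e.
  move=> e0; have e20 : 0 < e / 2 by lra.
  have [p Fp] := Fex _ e20; have [x px] := cdistP p e20.
  exists x => y; rewrite -(subrK (cdist p y) (f y)) -addrA.
  apply: (le_trans (ler_normD _ _)).
  by have := close _ _ Fp y; have := px y; lra.
apply/cvg_ex; exists (Completion fP); apply/cvg_ballP => e e0.
have e20 : 0 < e / 2 by lra.
have [p Fp] := Fex _ e20; near=> q.
have pq : mdist p q < e / 2.
  by have : ball p (e / 2) q by [near: q]; rewrite ballEmdist.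
rewrite ballEmdist /=; apply: (le_lt_trans (metric_triangle _ p _)).
suff : mdist (Completion fP) p <= e / 2 by lra.
by apply: completion_dist_le => y; exact: close.
Unshelve. all: by end_near. Qed.

HB.instance Definition _ :=
  Uniform_isComplete.Build (completion M) completion_complete.

End completion.

(** * Decorations and gluing *)

Definition decoration (R : realType) := word -> block R.

Section lcp_theory.
Implicit Types u v w : word.

Lemma lcpC u v : lcp u v = lcp v u.
Proof.
by elim: u v => [|a u IHu] [|b v] //=; rewrite eq_sym; case: eqP => // ->;
  rewrite IHu.
Qed.

Lemma lcp_prefixl u v : prefix (lcp u v) u.
Proof.
elim: u v => [|a u IHu] [|b v] //=; case: eqP => // _.
by rewrite eqxx IHu.
Qed.

Lemma lcp_prefixr u v : prefix (lcp u v) v.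
Proof. by rewrite lcpC lcp_prefixl. Qed.

Lemma prefix_lcp w u v : prefix w u -> prefix w v -> prefix w (lcp u v).
Proof.
elim: w u v => [u v _ _|c w IHw [|a u] [|b v]] //=; first exact: prefix0s.
by move=> /andP[/eqP<- wu] /andP[/eqP<- wv]; rewrite eqxx /= eqxx IHw.
Qed.

Lemma prefix_of_size u v w :
  prefix u w -> prefix v w -> (size u <= size v)%N -> prefix u v.
Proof.
rewrite [prefix u w]prefixE [prefix v w]prefixE => /eqP uw /eqP vw uv.
by rewrite prefixE -vw take_takel // uw.
Qed.

End lcp_theory.

Section gluing.
Variables (R : realType) (D : decoration R).

Definition union_blocks := {u : word & D u}.

HB.instance Definition _ := gen_eqMixin union_blocks.
HB.instance Definition _ := gen_choiceMixin union_blocks.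

Implicit Types (x y z t : union_blocks) (u v w : word).

Definition in_block u (x : D u) : union_blocks := existT _ u x.

(* The map pi_w; it is only relevant when w is a prefix of the index u of the
   block of y, and the i such that the child of w with letter i is a prefix of
   u is then the letter of u at position size w. *)
Definition proj y w : D w :=
  match tag y =P w with
  | ReflectT e => eq_rect _ (fun v => carrier (D v)) (tagged y) w e
  | ReflectF _ => marked (D w) (nth 0%N (tag y) (size w))
  end.

(* The sum over all w' such that w < w' <= tag y. *)
Definition height w y : R :=
  \sum_((size w).+1 <= k < (size (tag y)).+1)
     mdist (root (D (take k (tag y)))) (proj y (take k (tag y))).

Definition gluing_dist y z : R :=
  let w := lcp (tag y) (tag z) in
  mdist (proj y w) (proj z w) + height w y + height w z.

Definition glue_step y z : Prop :=
  exists u i, y = in_block (marked (D u) i) /\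
              z = in_block (root (D (rcons u i))).

Definition glued : union_blocks -> union_blocks -> Prop :=
  clos_refl_sym_trans _ glue_step.

Lemma proj_self u (x : D u) : proj (in_block x) u = x.
Proof.
rewrite /proj /=; case: eqP => // e.
by rewrite (Prop_irrelevance e erefl).
Qed.

Lemma proj_neq y w : tag y <> w ->
  proj y w = marked (D w) (nth 0%N (tag y) (size w)).
Proof. by rewrite /proj; case: eqP. Qed.

Lemma in_block_proj y w : tag y = w -> in_block (proj y w) = y.
Proof. by case: y => u x /= <-; rewrite -/(in_block x) proj_self. Qed.

Lemma proj_prefix y w w' : prefix w w' -> w <> w' -> prefix w' (tag y) ->
  proj y w = marked (D w) (nth 0%N w' (size w)).
Proof.
move=> ww' nww' w'y.
have sw : (size w < size w')%N.
  rewrite ltn_neqAle (size_prefix ww') andbT; apply: contra_notN nww' => /eqP e.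
  by move: ww'; rewrite prefixE e take_size => /eqP.
rewrite proj_neq; last first.
  by move=> e; have := size_prefix w'y; rewrite e leqNgt sw.
by case/prefixP: w'y => s ->; rewrite nth_cat sw.
Qed.

Lemma height_ge0 w y : 0 <= height w y.
Proof. by apply: sumr_ge0 => k _; exact: mdist_ge0. Qed.

Lemma height_self y : height (tag y) y = 0.
Proof. by rewrite /height big_geq. Qed.

Local Definition chain w w' : R := \sum_((size w).+1 <= k < size w')
  mdist (root (D (take k w'))) (marked (D (take k w')) (nth 0%N w' k)).

Local Lemma chain_ge0 w w' : 0 <= chain w w'.
Proof. by apply: sumr_ge0 => k _; exact: mdist_ge0. Qed.

Local Lemma height_split w w' y : prefix w w' -> w <> w' -> prefix w' (tag y) ->
  height w y = chain w w' + mdist (root (D w')) (proj y w') + height w' y.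
Proof.
move=> ww' nww' w'y.
have sw : (size w < size w')%N.
  rewrite ltn_neqAle (size_prefix ww') andbT; apply: contra_notN nww' => /eqP e.
  by move: ww'; rewrite prefixE e take_size => /eqP.
have sy := size_prefix w'y.
have tk k : (k <= size w')%N -> take k (tag y) = take k w'.
  by move=> kw'; move: w'y; rewrite prefixE => /eqP e;
    rewrite -[in RHS]e take_takel.
rewrite /height (@big_cat_nat _ _ _ (size w').+1) //=; last exact: leqW.
congr (_ + _); rewrite big_nat_recr //=; congr (_ + _).
  apply: eq_big_nat => k /andP[_ kw'].
  rewrite (tk _ (ltnW kw')); congr mdist.
  have := @proj_prefix y (take k w') w' (prefix_take _ _) _ w'y.
  rewrite size_takel ?(ltnW kw')//; apply.
  by move=> e; have := size_takel (ltnW kw'); rewrite e => e'; move: kw';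
    rewrite e' ltnn.
by rewrite tk // take_size.
Qed.

Local Lemma gluing_dist_le y z w : prefix w (tag y) -> prefix w (tag z) ->
  gluing_dist y z <= mdist (proj y w) (proj z w) + height w y + height w z.
Proof.
move=> wy wz; rewrite /gluing_dist /=; set c := lcp _ _.
have wc : prefix w c by exact: prefix_lcp.
have cy : prefix c (tag y) := lcp_prefixl _ _.
have cz : prefix c (tag z) := lcp_prefixr _ _.
have [->//|/eqP nwc] := eqVneq w c.
rewrite (height_split wc nwc cy) (height_split wc nwc cz).
have := chain_ge0 w c; have := mdist_ge0 (proj y w) (proj z w).
have := metric_triangle (proj y c) (root (D c)) (proj z c).
rewrite (metric_sym (proj y c) (root (D c))).
lra.
Qed.

Lemma gluing_distC y z : gluing_dist y z = gluing_dist z y.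
Proof. by rewrite /gluing_dist /= lcpC metric_sym addrAC. Qed.

Lemma gluing_distxx y : gluing_dist y y = 0.
Proof.
rewrite /gluing_dist /=.
have -> : lcp (tag y) (tag y) = tag y.
  by elim: (tag y) => //= a u IHu; rewrite eqxx IHu.
by rewrite mdistxx height_self !addr0.
Qed.

Lemma gluing_dist_ge0 y z : 0 <= gluing_dist y z.
Proof. by rewrite !addr_ge0 ?mdist_ge0 ?height_ge0. Qed.

Lemma gluing_dist_triangle z y t :
  gluing_dist y t <= gluing_dist y z + gluing_dist z t.
Proof.
wlog: y t / (size (lcp (tag y) (tag z)) <= size (lcp (tag z) (tag t)))%N.
  move=> h; have /orP[|h'] := leq_total (size (lcp (tag y) (tag z)))
    (size (lcp (tag z) (tag t))); first exact: h.
  rewrite gluing_distC (gluing_distC y z) (gluing_distC z t) addrC.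
  by apply: h; rewrite (lcpC (tag t)) (lcpC (tag z) (tag y)).
move=> sab.
have ab := prefix_of_size (lcp_prefixr _ _) (lcp_prefixl _ _) sab.
have bt := lcp_prefixr (tag z) (tag t); have bz := lcp_prefixl (tag z) (tag t).
have ay := lcp_prefixl (tag y) (tag z); have at_ := prefix_trans ab bt.
apply: (le_trans (gluing_dist_le ay at_)); rewrite {1}/gluing_dist /=.
move: ab bt bz ay at_ {sab}; rewrite /gluing_dist /=.
set a := lcp (tag y) _; set b := lcp _ _ => ab bt bz ay at_.
have hz := height_ge0 a z.
have [eab|/eqP nab] := eqVneq a b.
  rewrite -eab; have := metric_triangle (proj y a) (proj z a) (proj t a); lra.
rewrite (proj_prefix ab nab bt) (proj_prefix ab nab bz).
move: hz; rewrite (height_split ab nab bt) (height_split ab nab bz).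
have := metric_triangle (root (D b)) (proj z b) (proj t b).
have := chain_ge0 a b; have := mdist_ge0 (root (D b)) (proj z b).
have := height_ge0 b z.
lra.
Qed.

Lemma glue_step_dist y z : glue_step y z -> gluing_dist y z = 0.
Proof.
move=> [u [i [-> ->]]]; rewrite /gluing_dist /=.
have -> : lcp u (rcons u i) = u.
  by elim: u => //= a u IHu; rewrite eqxx IHu.
rewrite proj_self proj_neq /=; last first.
  by move=> /(congr1 size); rewrite size_rcons => /eqP; rewrite gtn_eqF.
rewrite nth_rcons ltnn eqxx mdistxx add0r.
have -> : height u (in_block (marked (D u) i)) = 0 by exact: height_self.
rewrite add0r /height /= size_rcons big_nat1.
have -> : take (size u).+1 (rcons u i) = rcons u i.
  by rewrite -(size_rcons u i) take_size.
by rewrite proj_self mdistxx.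
Qed.

Local Lemma height0_glued w y : prefix w (tag y) -> height w y = 0 ->
  glued y (in_block (proj y w)).
Proof.
move=> wy /eqP; rewrite /height.
rewrite (big_addn 0 _ (size w).+1) psumr_eq0; last first.
  by move=> k _; exact: mdist_ge0.
move=> /allP /= h0.
have hk k : (size w < k <= size (tag y))%N ->
    proj y (take k (tag y)) = root (D (take k (tag y))).
  move=> /andP[wk ky]; apply/esym/mdist_positivity/eqP.
  have := h0 (k - (size w).+1)%N; rewrite subnK //; apply.
  by rewrite mem_index_iota /= ltn_sub2r // (leq_ltn_trans wk).
suff h n k : (size w <= k)%N -> (k <= size (tag y))%N ->
    (size (tag y) - k)%N = n -> glued y (in_block (proj y (take k (tag y)))).
  have := h _ _ (leqnn _) (size_prefix wy) erefl.
  by move: wy; rewrite prefixE => /eqP ->.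
elim: n k => [|n IHn] k wk ky En.
  have ek : k = size (tag y).
    by apply/eqP; rewrite eqn_leq ky -subn_eq0 En.
  by rewrite in_block_proj ?ek ?take_size //; exact: rst_refl.
have kly : (k < size (tag y))%N by rewrite -subn_gt0 En.
apply: (@rst_trans _ _ _ (in_block (proj y (take k.+1 (tag y))))).
  by apply: IHn => //; [exact: leqW|rewrite subnS En].
apply: rst_sym; apply: rst_step; exists (take k (tag y)), (nth 0%N (tag y) k).
split.
  rewrite proj_neq ?size_takel //.
  by move=> e; have := size_takel ky; rewrite -e => e'; rewrite e' ltnn in kly.
by rewrite hk ?ltnS ?wk // (take_nth 0%N).
Qed.

Lemma gluing_dist_eq0 y z : gluing_dist y z = 0 <-> glued y z.
Proof.
split; last first.
  elim=> {y z} [y z /glue_step_dist //|y|y z _|y t z _ yt _ tz].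
  - exact: gluing_distxx.
  - by rewrite gluing_distC.
  - apply/le_anti; rewrite gluing_dist_ge0 andbT.
    by apply: le_trans (gluing_dist_triangle t y z) _; rewrite yt tz addr0.
rewrite /gluing_dist /=; set w := lcp _ _ => h.
have h1 := mdist_ge0 (proj y w) (proj z w).
have h2 := height_ge0 w y; have h3 := height_ge0 w z.
apply: (@rst_trans _ _ _ (in_block (proj y w))).
  by apply: height0_glued; [exact: lcp_prefixl|lra].
have -> : proj y w = proj z w by apply: mdist_positivity; lra.
by apply: rst_sym; apply: height0_glued; [exact: lcp_prefixr|lra].
Qed.

Local Definition gluedb : rel union_blocks := fun y z => `[< glued y z >].

Local Lemma gluedb_refl : reflexive gluedb.
Proof. by move=> y; apply/asboolP; exact: rst_refl. Qed.

Local Lemma gluedb_sym : symmetric gluedb.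
Proof. by move=> y z; apply/asboolP/asboolP; exact: rst_sym. Qed.

Local Lemma gluedb_trans : transitive gluedb.
Proof.
move=> y x z /asboolP xy /asboolP yz; apply/asboolP.
exact: (@rst_trans _ _ x y z).
Qed.

Canonical glued_equiv := EquivRel gluedb gluedb_refl gluedb_sym gluedb_trans.

(* The space G^*(D). *)
Definition pre_gluing : Type := {eq_quot glued_equiv}%qT.

HB.instance Definition _ := Choice.on pre_gluing.

Definition to_pre_gluing y : pre_gluing := (\pi_{eq_quot glued_equiv} y)%qT.

HB.instance Definition _ := isPointed.Build pre_gluing
  (to_pre_gluing (in_block (root (D [::])))).

Definition pre_gluing_dist (p q : pre_gluing) : R :=
  gluing_dist (repr (p : {eq_quot glued_equiv}%qT))
              (repr (q : {eq_quot glued_equiv}%qT)).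

Lemma to_pre_gluingP y z : to_pre_gluing y = to_pre_gluing z <-> glued y z.
Proof. by split=> [/eqquotP/asboolP|h]; last by apply/eqquotP/asboolP. Qed.

Lemma pre_gluing_distE y z :
  pre_gluing_dist (to_pre_gluing y) (to_pre_gluing z) = gluing_dist y z.
Proof.
have aux a b c : glued a b -> gluing_dist a c = gluing_dist b c.
  move=> /gluing_dist_eq0 ab.
  have := gluing_dist_triangle a b c; have := gluing_dist_triangle b a c.
  by rewrite (gluing_distC b a) ab !add0r => ? ?; apply/le_anti/andP.
have g a : glued (repr (to_pre_gluing a : {eq_quot glued_equiv}%qT)) a.
  by apply/to_pre_gluingP; rewrite /to_pre_gluing reprK.
rewrite /pre_gluing_dist (aux _ _ _ (g y)) gluing_distC (aux _ _ _ (g z)).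
exact: gluing_distC.
Qed.

Local Lemma pre_gluing_distxx p : pre_gluing_dist p p = 0.
Proof. exact: gluing_distxx. Qed.

Local Lemma pre_gluing_dist_eq0 p q : pre_gluing_dist p q = 0 -> p = q.
Proof.
move=> /gluing_dist_eq0/to_pre_gluingP.
by rewrite /to_pre_gluing !reprK.
Qed.

Local Lemma pre_gluing_distC p q : pre_gluing_dist p q = pre_gluing_dist q p.
Proof. exact: gluing_distC. Qed.

Local Lemma pre_gluing_dist_triangle q p r :
  pre_gluing_dist p r <= pre_gluing_dist p q + pre_gluing_dist q r.
Proof. exact: gluing_dist_triangle. Qed.

HB.instance Definition _ := isMetric.Build R pre_gluing
  pre_gluing_distxx pre_gluing_dist_eq0 pre_gluing_distC
  pre_gluing_dist_triangle.

Definition gluing : pmetricType R := completion pre_gluing.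

Definition block_inj u (x : D u) : gluing :=
  to_completion (to_pre_gluing (in_block x)).

Lemma block_injE u v (x : D u) (y : D v) :
  mdist (block_inj x) (block_inj y) = gluing_dist (in_block x) (in_block y).
Proof. by rewrite to_completion_isometric; exact: pre_gluing_distE. Qed.

Definition gluing_measure
    (nu : forall u, {measure set (borel (D u)) -> \bar R}) :
    set (borel gluing) -> \bar R :=
  fun A => \esum_(u in [set: word])
    @pushforward _ _ (borel (D u)) (borel gluing) _ (nu u) (@block_inj u) A.

(* The marked point x_(i_1 ... i_n) with n >= 1 lies in the block indexed by
   i_1 ... i_(n-1). *)
Definition ray_limit (x : nat -> nat) : gluing :=
  limn (fun n => block_inj (marked (D (mkseq x n)) (x n))).

(* The push-forward by ray_limit of the restriction of mu to the infinite
   words. *)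
Definition ray_measure (mu : set ulam_bar -> \bar R) :
    set (borel gluing) -> \bar R :=
  fun A => mu (Ray @` (ray_limit @^-1` A)).

End gluing.
Arguments ray_limit {R} D x.
Arguments ray_measure {R} D mu.

(** * Weak convergence *)

Definition weak_cvg (R : realType) (T : ptopologicalType)
    (P : nat -> probability (borel T) R) (Q : probability (borel T) R) : Prop :=
  forall f : T -> R, continuous f -> (exists C : R, forall x, `|f x| <= C) ->
    (fun n => \int[P n]_x (f x)%:E)%E @ \oo --> (\int[Q]_x (f x)%:E)%E.

(* Main.v *)
(* Fix e > 0 and, by non-explosion, a finite plane tree theta beyond which all
   branches have total diameter at most e.  The blocks D n u and Doo u with u in
   theta are related by correspondences of small distortion that preserve the
   root and the first marked points; through the explicit gluing metric these
   combine into a correspondence of small distortion between the two trunks, the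
   trunks being e-dense in the gluings.  The amalgam of the two gluings along
   this correspondence gives the Gromov-Hausdorff convergence.  For the measures,
   all blocks and all ray limits beyond a boundary word wi of theta are within e
   of the marked point i of the block w; finitely many boundary words carry most
   of the mass of nuoo, and the masses of their cones, which are clopen, converge
   by weak convergence. *)

Require Import Defs.
From mathcomp Require Import all_boot all_order all_algebra.
From mathcomp Require Import all_classical all_reals all_analysis.
From mathcomp Require Import lra.
From HB Require Import structures.

Import Order.TTheory GRing.Theory Num.Def Num.Theory.
Import numFieldNormedType.Exports.

Local Open Scope classical_set_scope.
Local Open Scope ring_scope.

Set Implicit Arguments.
Unset Strict Implicit.
Unset Printing Implicit Defensive.

(** * Correspondences and amalgams *)

(** The open balls of integer radius around the base point cover the space, so finitely many of them
    do. *)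
Lemma mdist_bounded (R : realType) (X : pmetricType R) :
  compact [set: X] -> exists M : R, forall x y : X, mdist x y <= M.
Proof.
rewrite compact_cover => /(_ nat setT (fun n => [set y | mdist point y < n%:R])).
case=> [n _|x _|s _ sX].
- rewrite openE => y /= yn; apply/nbhs_ballP.
  exists (n%:R - mdist (point : X) y) => /=; first by rewrite subr_gt0.
  move=> z; rewrite ballEmdist /= => yz.
  by apply: (le_lt_trans (metric_triangle _ y _)); rewrite -ltrBrDl.
- exists (Num.bound (mdist (point : X) x)) => //=.
  by rewrite archi_boundP ?mdist_ge0.
(* The sum of the finitely many radii stands in for their maximum. *)
pose M : R := \sum_(n <- finmap.enum_fset s) n%:R.
have sM (x : X) : mdist point x <= M.
  have [n ns xn] := sX x I; apply/ltW/(lt_le_trans xn).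
  rewrite /M (bigD1_seq n) ?finmap.fset_uniq //= lerDl.
  exact: sumr_ge0.
exists (M + M) => x y; apply: (le_trans (metric_triangle _ point _)).
by rewrite lerD // metric_sym.
Qed.

Section amalgam.
Context {R : realType} {X Y : pmetricType R}.

(** A partial relation suits the gluings: only trunk points get related, and the other points are
    reached by density. The radius is half the allowed distortion. *)
Record correspondence := Correspondence {
  corr : X -> Y -> Prop;
  corr_radius : R;
  corr_radius_gt0 : 0 < corr_radius;
  corr_nonempty : exists x y, corr x y;
  corr_distortion : forall x y x' y', corr x y -> corr x' y' ->
    `|mdist x x' - mdist y y'| <= 2 * corr_radius }.

(* The unused argument selects the metric on X + Y. *)
Definition amalgam_type (c : correspondence) : Type := (X + Y)%type.

Variable c : correspondence.
Local Notation r := (corr_radius c).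
Local Notation amalgam := (amalgam_type c).

HB.instance Definition _ := gen_eqMixin amalgam.
HB.instance Definition _ := gen_choiceMixin amalgam.
HB.instance Definition _ := isPointed.Build amalgam (inl point).

Definition cross_set (x : X) (y : Y) : set R :=
  [set d | exists a b, corr c a b /\ d = mdist x a + mdist b y].

(** The length of a shortest path from [x] to [y] that crosses one bridge of length [r] between
    related points. *)
Definition cross_dist x y : R := r + inf (cross_set x y).

Lemma cross_set_has_inf x y : has_inf (cross_set x y).
Proof.
split.
  by have [a [b ab]] := corr_nonempty c; exists (mdist x a + mdist b y), a, b.
by exists 0 => _ [a [b [_ ->]]]; rewrite addr_ge0 ?mdist_ge0.
Qed.

Lemma cross_dist_le x y a b :
  corr c a b -> cross_dist x y <= r + (mdist x a + mdist b y).
Proof.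
move=> ab; rewrite lerD2l; apply: ge_inf; last by exists a, b.
by case: (cross_set_has_inf x y).
Qed.

Lemma le_cross_dist x y (e : R) :
  (forall a b, corr c a b -> e <= r + (mdist x a + mdist b y)) ->
  e <= cross_dist x y.
Proof.
move=> h; rewrite /cross_dist -lerBlDl; apply: lb_le_inf.
  by case: (cross_set_has_inf x y).
by move=> _ [a [b [ab ->]]]; rewrite lerBlDl h.
Qed.

Definition amalgam_dist (p q : amalgam) : R :=
  match p, q with
  | inl x, inl x' => mdist x x'
  | inr y, inr y' => mdist y y'
  | inl x, inr y | inr y, inl x => cross_dist x y
  end.

(** Every bridge has positive length, so the two copies stay disjoint and the amalgam is a true
    metric space. *)
Lemma cross_dist_gt0 x y : 0 < cross_dist x y.
Proof.
apply: (lt_le_trans (corr_radius_gt0 c)); apply: le_cross_dist => a b _.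
by rewrite lerDl addr_ge0 ?mdist_ge0.
Qed.

Lemma amalgam_distxx p : amalgam_dist p p = 0.
Proof. by case: p => x /=; rewrite mdistxx. Qed.

Lemma amalgam_dist_eq0 p q : amalgam_dist p q = 0 -> p = q.
Proof.
case: p q => [x|y] [x'|y'] /=.
- by move=> /mdist_positivity ->.
- by move=> h; have := cross_dist_gt0 x y'; rewrite h ltxx.
- by move=> h; have := cross_dist_gt0 x' y; rewrite h ltxx.
- by move=> /mdist_positivity ->.
Qed.

Lemma amalgam_distC p q : amalgam_dist p q = amalgam_dist q p.
Proof. by case: p q => [x|y] [x'|y'] //=; rewrite metric_sym. Qed.

Lemma cross_dist_trianglel x x' y :
  cross_dist x y <= mdist x x' + cross_dist x' y.
Proof.
rewrite -lerBlDl; apply: le_cross_dist => a b ab; rewrite lerBlDl.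
apply: (le_trans (cross_dist_le x y ab)).
have := metric_triangle x x' a; lra.
Qed.

Lemma cross_dist_triangler x y y' :
  cross_dist x y <= cross_dist x y' + mdist y' y.
Proof.
rewrite -lerBlDr; apply: le_cross_dist => a b ab; rewrite lerBlDr.
apply: (le_trans (cross_dist_le x y ab)).
have := metric_triangle b y' y; lra.
Qed.

(** A detour through the other side crosses two bridges; their total length [2 * r] pays for the
    distortion between the two related pairs. *)
Lemma cross_dist_back_l x x' y :
  mdist x x' <= cross_dist x y + cross_dist x' y.
Proof.
rewrite -lerBlDr; apply: le_cross_dist => a b ab; rewrite lerBlDr -lerBlDl.
apply: le_cross_dist => a' b' ab'; rewrite lerBlDl.
have := corr_distortion ab ab'; rewrite ler_norml => /andP[_ h].
have := metric_triangle x a x'; have := metric_triangle a a' x'.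
have := metric_triangle b y b'; rewrite (metric_sym y b') (metric_sym a' x').
lra.
Qed.

Lemma cross_dist_back_r x y y' :
  mdist y y' <= cross_dist x y + cross_dist x y'.
Proof.
rewrite -lerBlDr; apply: le_cross_dist => a b ab; rewrite lerBlDr -lerBlDl.
apply: le_cross_dist => a' b' ab'; rewrite lerBlDl.
have := corr_distortion ab ab'; rewrite ler_norml => /andP[h _].
have := metric_triangle y b y'; have := metric_triangle b b' y'.
have := metric_triangle a x a'; rewrite (metric_sym y b) (metric_sym a x).
lra.
Qed.

Lemma amalgam_dist_triangle q p s :
  amalgam_dist p s <= amalgam_dist p q + amalgam_dist q s.
Proof.
case: p q s => [x|y] [x'|y'] [x''|y''] /=.
- exact: metric_triangle.
- exact: cross_dist_trianglel.
- exact: cross_dist_back_l.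
- exact: cross_dist_triangler.
- by have := cross_dist_trianglel x'' x' y; rewrite (metric_sym x''); lra.
- exact: cross_dist_back_r.
- by have := cross_dist_triangler x'' y y'; rewrite (metric_sym y); lra.
- exact: metric_triangle.
Qed.

HB.instance Definition _ := isMetric.Build R amalgam
  amalgam_distxx amalgam_dist_eq0 amalgam_distC amalgam_dist_triangle.

Lemma amalgam_inl_isometric : isometric (inl : X -> amalgam).
Proof. by []. Qed.

Lemma amalgam_inr_isometric : isometric (inr : Y -> amalgam).
Proof. by []. Qed.

Lemma amalgam_corr x y : corr c x y ->
  mdist (inl x : amalgam) (inr y) <= r.
Proof.
move=> /(cross_dist_le x y) h; apply: (le_trans h).
by rewrite !mdistxx !addr0.
Qed.

End amalgam.
Arguments correspondence {R} X Y.

Lemma correspondence_embedding (R : realType) (X Y : pmetricType R) (C : X -> Y -> Prop) (r : R) :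
  0 < r -> (exists x y, C x y) ->
  (forall x y x' y', C x y -> C x' y' -> `|mdist x x' - mdist y y'| <= 2 * r) ->
  exists (Z : pmetricType R) (f : X -> Z) (g : Y -> Z),
    [/\ isometric f, isometric g & forall x y, C x y -> mdist (f x) (g y) <= r].
Proof.
move=> r0 C0 Cr; pose c := Correspondence r0 C0 Cr.
exists (amalgam_type c), inl, inr; split.
- exact: amalgam_inl_isometric.
- exact: amalgam_inr_isometric.
- exact: (@amalgam_corr _ _ _ c).
Qed.

(** * Pointed Gromov-Hausdorff distances and correspondences *)

Section gh.
Context {R : realType}.

Lemma hausdorff_dist_le (Z : pmetricType R) (A B : set Z) (e : R) :
  (forall a, A a -> exists2 b, B b & mdist a b <= e) ->
  (forall b, B b -> exists2 a, A a & mdist a b <= e) ->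
  (hausdorff_dist A B <= e%:E)%E.
Proof.
move=> AB BA; rewrite /hausdorff_dist ge_max; apply/andP; split.
  apply: ge_ereal_sup => _ [a Aa <-]; have [b Bb ab] := AB a Aa.
  by apply: ge_ereal_inf; exists (mdist a b)%:E; [exists b|rewrite lee_fin].
apply: ge_ereal_sup => _ [b Bb <-]; have [a Aa ab] := BA b Bb.
by apply: ge_ereal_inf; exists (mdist a b)%:E; [exists a|rewrite lee_fin].
Qed.

Lemma hausdorff_dist_lt (Z : pmetricType R) (A B : set Z) (e : R) :
  (hausdorff_dist A B < e%:E)%E ->
  (forall a, A a -> exists2 b, B b & mdist a b < e) /\
  (forall b, B b -> exists2 a, A a & mdist a b < e).
Proof.
rewrite /hausdorff_dist gt_max => /andP[h1 h2]; split.
  move=> a Aa.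
  have /ereal_inf_lt[_ [b Bb <-]] : (ereal_inf [set (mdist a b)%:E | b in B] < e%:E)%E.
    by apply: le_lt_trans h1; apply: ereal_sup_ubound; exists a.
  by rewrite lte_fin; exists b.
move=> b Bb.
have /ereal_inf_lt[_ [a Aa <-]] : (ereal_inf [set (mdist a b)%:E | a in A] < e%:E)%E.
  by apply: le_lt_trans h2; apply: ereal_sup_ubound; exists b.
by rewrite lte_fin; exists a.
Qed.

(** A supremum over an empty set would be [-oo]; the range of a pointed space is non-empty, so the
    first supremum dominates a nonnegative value. *)
Lemma hausdorff_dist_ge0 (X Y Z : pmetricType R) (f : X -> Z) (B : set Z) :
  (0 <= hausdorff_dist (range f) B)%E.
Proof.
rewrite /hausdorff_dist le_max; apply/orP; left.
apply: (@le_trans _ _ (ereal_inf [set (mdist (f point) b)%:E | b in B])).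
  by apply: le_ereal_inf_tmp => _ [b _ <-]; rewrite lee_fin mdist_ge0.
by apply: ereal_sup_ubound; exists (f point) => //; exists point.
Qed.

Record block_corr (k : nat) (X Y : block R) (e : R) (C : X -> Y -> Prop) : Prop := {
  block_corr_total : forall x, exists y, C x y;
  block_corr_surj : forall y, exists x, C x y;
  block_corr_root : C (Defs.root X) (Defs.root Y);
  block_corr_marked : forall i, (i < k)%N -> C (marked X i) (marked Y i);
  block_corr_distortion : forall x y x' y', C x y -> C x' y' ->
    `|mdist x x' - mdist y y'| <= 2 * e }.

(** Relate the points whose images in the common space are less than [e] apart; swapping both ends
    of a pair then changes a distance by less than [2 * e]. *)
Lemma GH_dist_pt_corr k (X Y : block R) (e : R) :
  (GH_dist_pt k X Y < e%:E)%E -> exists C : X -> Y -> Prop, block_corr k e C.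
Proof.
move=> /ereal_inf_lt[_ [Z [f [g [fi gi ->]]]]]; rewrite gt_max => /andP[].
move=> /hausdorff_dist_lt[fg gf].
move=> /bigmax_ltP[_ ptd].
exists (fun x y => mdist (f x) (g y) < e); split.
- by move=> x; have [_ [y _ <-] xy] := fg (f x) (ex_intro2 _ _ x I erefl); exists y.
- by move=> y; have [_ [x _ <-] xy] := gf (g y) (ex_intro2 _ _ y I erefl); exists x.
- by have := ptd ord0 isT; rewrite lte_fin.
(* [marked X i] is [rho X i.+1], so the distance of order [k] controls the marked points of index
   below [k]. *)
- move=> i ik; have ik' : (i.+1 < k.+1)%N by [].
  by have := ptd (Ordinal ik') isT; rewrite lte_fin.
- move=> x y x' y' xy xy'; rewrite -(fi x) -(gi y) ler_norml.
  have := metric_triangle (f x) (g y) (f x').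
  have := metric_triangle (g y) (g y') (f x').
  have := metric_triangle (g y) (f x) (g y').
  have := metric_triangle (f x) (f x') (g y').
  rewrite (metric_sym (g y) (f x)) (metric_sym (g y') (f x')).
  by move=> *; apply/andP; split; lra.
Qed.

Lemma GH_dist_pt_ge0 k (X Y : block R) : (0 <= GH_dist_pt k X Y)%E.
Proof.
apply: le_ereal_inf_tmp => _ [Z [f [g [_ _ ->]]]].
by rewrite le_max hausdorff_dist_ge0.
Qed.

(** The series has nonnegative terms, so its sum dominates the term of index [k]. Summation starts
    at 1, whence [0 < k]; the threshold [2 ^- k * e] undoes the weight. *)
Lemma GH_dist_pt_near (X : nat -> block R) (Y : block R) (k : nat) (e : R) :
  (fun n => GH_dist_infty (X n) Y) @ \oo --> 0%E -> (0 < k)%N -> 0 < e ->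
  \forall n \near \oo, (GH_dist_pt k (X n) Y < e%:E)%E.
Proof.
move=> XY k0 e0.
have c0 : 0 < 2 ^- k * e by rewrite mulr_gt0 // invr_gt0 exprn_gt0.
near=> n.
have : (GH_dist_infty (X n) Y < (2 ^- k * e)%:E)%E.
  near: n; apply: (XY [set x | (x < (2 ^- k * e)%:E)%E]).
  by apply: open_nbhs_nbhs; split; [exact: open_ereal_lt_ereal|rewrite /= lte_fin].
rewrite EFinM => h.
have : ((2 ^- k)%:E * GH_dist_pt k (X n) Y < (2 ^- k)%:E * e%:E)%E.
  apply: le_lt_trans h; rewrite /GH_dist_infty.
  have h0 i : (0 <= (2 ^- i)%:E * GH_dist_pt i (X n) Y)%E.
    by rewrite mule_ge0 ?GH_dist_pt_ge0 // lee_fin invr_ge0 exprn_ge0.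
  apply: le_trans (nneseries_lim_ge k.+1 _) => //.
  by rewrite big_nat_recr //= leeDr // sume_ge0.
by rewrite lte_pmul2l // lte_fin invr_gt0 exprn_gt0.
Unshelve. all: by end_near. Qed.

Lemma diam_ge (X : block R) (x y : X) : mdist x y <= diam X.
Proof.
have [M XM] := mdist_bounded (@block_compact R X).
by apply: ub_le_sup; [exists M => _ [p _ <-]|exists (x, y)].
Qed.

Lemma diam_le (X : block R) (e : R) : (forall x y : X, mdist x y <= e) -> diam X <= e.
Proof.
move=> h; apply: ge_sup; first by exists (mdist (point : X) point), (point, point).
by move=> _ [p _ <-].
Qed.

(** The real [sup] of an unbounded set is a default value, so the diameters must first be shown to
    be bounded; convergence gives this. The bound then passes to the limit block, so that one weight
    serves all the decorations. *)
Lemma cvg_sup_diam (X : nat -> block R) (Y : block R) :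
  (fun n => GH_dist_infty (X n) Y) @ \oo --> 0%E ->
  (forall n (x y : X n), mdist x y <= sup (range (fun n => diam (X n)))) /\
  (forall x y : Y, mdist x y <= sup (range (fun n => diam (X n)))).
Proof.
move=> XY.
have bnd : has_ubound (range (fun n => diam (X n))).
  have [N _ XN] := GH_dist_pt_near XY (isT : (0 < 1)%N) (@ltr01 R).
  have d0 (Z : block R) : 0 <= diam Z.
    by rewrite -(mdistxx (point : Z)) diam_ge.
  (* From [N] on a correspondence of distortion at most 2 compares with [Y]; the sum dominates the
     diameters before [N]. *)
  exists (\sum_(i < N) diam (X i) + (diam Y + 2)) => _ [n _ <-].
  have [nN|/XN/GH_dist_pt_corr[C [Ct _ _ _ Cd]]] := ltnP n N.
    rewrite (bigD1 (Ordinal nN)) //= -!addrA lerDl.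
    by apply: addr_ge0; [exact: sumr_ge0|exact: addr_ge0].
  apply: (@le_trans _ _ (diam Y + 2)); last by rewrite lerDr sumr_ge0.
  apply: diam_le => x x'.
  have [[y xy] [y' xy']] := (Ct x, Ct x').
  have := Cd _ _ _ _ xy xy'; have := diam_ge y y'.
  rewrite ler_norml => ? /andP[_]; lra.
have Xs n (x y : X n) : mdist x y <= sup (range (fun n => diam (X n))).
  by apply: (le_trans (diam_ge x y)); apply: ub_le_sup => //; exists n.
split=> // y y'; apply/ler_addgt0Pl => e e0.
have e20 : 0 < e / 2 by lra.
have [N _ /(_ N (leqnn N))/GH_dist_pt_corr[C [_ Cs _ _ Cd]]] :=
  GH_dist_pt_near XY (isT : (0 < 1)%N) e20.
have [[x xy] [x' xy']] := (Cs y, Cs y').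
have := Cd _ _ _ _ xy xy'; have := Xs _ x x'.
rewrite ler_norml => ? /andP[]; lra.
Qed.

Lemma cvge0P (u : nat -> \bar R) : (forall n, (0 <= u n)%E) ->
  (forall e : R, 0 < e -> \forall n \near \oo, (u n <= e%:E)%E) -> u @ \oo --> 0%E.
Proof.
move=> u0 ue; apply/fine_cvgP; split.
  apply: filterS (ue 1 ltr01) => n un; rewrite ge0_fin_numE //.
  by apply: le_lt_trans un _; rewrite ltry.
apply/cvgrPdist_le => e e0; apply: filterS (ue e e0) => n un /=.
have un_fin : u n \is a fin_num.
  by rewrite ge0_fin_numE //; apply: le_lt_trans un _; rewrite ltry.
by rewrite sub0r normrN ger0_norm ?fine_ge0 // -lee_fin fineK.
Qed.

End gh.

(** * Branches of the gluing outside a plane tree *)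

Section words.
Implicit Types (u v w : seq nat) (theta : set (seq nat)).

Lemma prefix_closed theta u v : (forall w i, theta (rcons w i) -> theta w) ->
  prefix u v -> theta v -> theta u.
Proof.
move=> cl /prefixP[s ->]; elim/last_ind: s => [|s i IHs]; first by rewrite cats0.
by rewrite -rcons_cat => /cl.
Qed.

(** Follow the branch towards [u] until it leaves [theta]: these boundary words are the roots of the
    branches cut off by the trunk. *)
Lemma exit_word theta u : theta [::] -> ~ theta u ->
  exists w i, [/\ theta w, ~ theta (rcons w i) & prefix (rcons w i) u].
Proof.
move=> t0; elim/last_ind: u => [//|u i IHu] nu.
have [tu|/IHu[w [j [tw ntj ju]]]] := pselect (theta u).
  by exists u, i; split => //; exact: prefix_refl.
exists w, j; split => //; apply: prefix_trans ju _.
exact: prefix_rcons.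
Qed.

Lemma prefix_mkseq (x : nat -> nat) m n : (m <= n)%N -> prefix (mkseq x m) (mkseq x n).
Proof.
move=> mn; rewrite prefixE size_mkseq /mkseq -map_take take_iota.
by rewrite (minn_idPl mn).
Qed.

(** The prefixes of a ray have distinct lengths, so a finite set cannot contain them all. *)
Lemma exit_ray theta (x : nat -> nat) : finite_set theta -> theta [::] ->
  exists m, theta (mkseq x m) /\ ~ theta (mkseq x m.+1).
Proof.
move=> /finite_seqP[s ->] t0; apply: contrapT => nm.
have all_in m : mkseq x m \in s.
  elim: m => // m IHm; apply: contrapT => h; apply: nm; exists m; split => //.
have : (size [seq mkseq x m | m <- iota 0 (size s).+1] <= size s)%N.
  apply: uniq_leq_size; last by move=> _ /mapP[m _ ->].
  rewrite map_inj_uniq ?iota_uniq // => m n /(congr1 size).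
  by rewrite !size_mkseq.
by rewrite size_map size_iota ltnn.
Qed.

Lemma plane_tree_root theta : plane_tree theta -> theta [::].
Proof.
by case=> _ [u tu] cl _; apply: prefix_closed tu => //; exact: prefix0s.
Qed.

Lemma non_explosive_tree (R : realType) (l : seq nat -> R) (e : R) :
  non_explosive l -> 0 < e -> exists2 theta, plane_tree theta &
    forall u, \sum_(k < (size u).+1 | take k u \notin theta) l (take k u) <= e.
Proof.
move=> nl e0.
have /ereal_inf_lt[_ [theta pt <-]] : (ereal_inf [set ereal_sup
    [set (\sum_(k < (size u).+1 | take k u \notin theta) l (take k u))%:E
      | u in [set: seq nat]] | theta in plane_tree] < e%:E)%E.
  by rewrite nl lte_fin.
move=> te; exists theta => // u; rewrite -lee_fin; apply: le_trans (ltW te).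
by apply: ereal_sup_ubound; exists u.
Qed.

End words.

Section branches.
Context {R : realType} (D : decoration R) (l : seq nat -> R).
Hypothesis Dl : forall u (x y : D u), mdist x y <= l u.
Implicit Types (u v w : seq nat) (x : nat -> nat).

Lemma branch_weight_ge0 u : 0 <= l u.
Proof. by rewrite -(mdistxx (point : D u)). Qed.

Section tree.
Variables (theta : set (seq nat)) (e : R).
Hypothesis theta_parent : forall u i, theta (rcons u i) -> theta u.
Hypothesis theta_tail : forall u,
  \sum_(k < (size u).+1 | take k u \notin theta) l (take k u) <= e.

(** All prefixes of [u] longer than [w] extend [rcons w i], hence lie outside [theta]. The terms of
    the height are thus dominated by terms of the tail sum along [u]. *)
Lemma height_le w i u (y : D u) : ~ theta (rcons w i) -> prefix (rcons w i) u ->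
  height w (in_block y) <= e.
Proof.
move=> nwi wiu; apply: le_trans (theta_tail u).
have wu : (size w < size u)%N.
  by have := size_prefix wiu; rewrite size_rcons.
(* The tail sum becomes a sum over an interval of lengths, whose part up to [size w] is nonnegative
   and dropped. *)
rewrite -(big_mkord (fun k => take k u \notin theta) (fun k => l (take k u))).
rewrite big_mkcond (@big_cat_nat _ _ _ (size w).+1) //=; last by apply: ltnW.
apply: (@le_trans _ _ (\sum_((size w).+1 <= k < (size u).+1)
    if take k u \notin theta then l (take k u) else 0)); last first.
  rewrite lerDr; apply: sumr_ge0 => k _; case: ifP => // _.
  exact: branch_weight_ge0.
apply: ler_sum_nat => k /andP[wk ku]; rewrite ifT ?Dl //.
apply/negP => /set_mem tk; apply: nwi; apply: prefix_closed theta_parent _ tk.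
apply: (prefix_of_size wiu (prefix_take u k)).
by rewrite size_rcons size_takel.
Qed.

(** The projection of [y] to the block of [w] is the marked point [i] itself, so only the height of
    [y] above [w] remains: seen from the trunk, a whole branch shrinks to its attachment point. *)
Lemma branch_dist w i u (y : D u) : ~ theta (rcons w i) -> prefix (rcons w i) u ->
  mdist (block_inj (marked (D w) i)) (block_inj y) <= e.
Proof.
move=> nwi wiu; rewrite block_injE.
have wu : prefix w u by apply: prefix_trans wiu; exact: prefix_rcons.
apply: (le_trans (@Defs.gluing_dist_le _ _ (in_block (marked (D w) i))
  (in_block y) w (prefix_refl w) wu)).
rewrite proj_self (@proj_prefix _ _ _ w (rcons w i)) ?prefix_rcons //; last first.
  by move=> /(congr1 size)/eqP; rewrite size_rcons ltn_eqF.
rewrite nth_rcons ltnn eqxx mdistxx add0r.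
rewrite (height_self (in_block (marked (D w) i))) add0r.
exact: height_le nwi wiu.
Qed.

Hypothesis theta_root : theta [::].

(** The slack [d] pays for approximating a point of the completion by a block point, and [e] for
    moving the latter to where its branch leaves the trunk. *)
Lemma trunk_dense (p : gluing D) (d : R) : 0 < d ->
  exists u (y : D u), theta u /\ mdist p (block_inj y) <= e + d.
Proof.
move=> d0; have [q pq] := to_completion_dense p d0.
(* The tail sum along the empty word is nonnegative and at most [e]. *)
have e0 : 0 <= e.
  apply: le_trans (theta_tail [::]); apply: sumr_ge0 => k _.
  exact: branch_weight_ge0.
have : to_pre_gluing (repr (q : {eq_quot (glued_equiv D)}%qT)) = q.
  by rewrite /to_pre_gluing reprK.
case: (repr _) => u y qE.
have {pq}pq : mdist p (block_inj y) < d by rewrite /block_inj qE.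
have [tu|ntu] := pselect (theta u).
  by exists u, y; split => //; apply: ltW (lt_le_trans pq _); rewrite lerDr.
have [w [i [tw nwi wiu]]] := exit_word theta_root ntu.
exists w, (marked (D w) i); split => //.
apply: (le_trans (metric_triangle _ (block_inj y) _)).
by rewrite addrC lerD ?(ltW pq) // metric_sym branch_dist.
Qed.

Lemma branch_dist_ray x m n : ~ theta (mkseq x m.+1) -> (m < n)%N ->
  mdist (block_inj (marked (D (mkseq x m)) (x m)))
    (block_inj (marked (D (mkseq x n)) (x n))) <= e.
Proof.
move=> nxm mn; apply: branch_dist; first by rewrite -mkseqS.
by rewrite -mkseqS prefix_mkseq.
Qed.

End tree.

Hypothesis l_non_explosive : non_explosive l.

(** [ray_limit] is defined by [limn], which is meaningful only for a convergent sequence. Once the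
    ray has left [theta], the sequence stays close to the marked point at the exit, so it is
    Cauchy. *)
Lemma ray_limit_cvg x :
  (fun n => block_inj (marked (D (mkseq x n)) (x n))) @ \oo --> ray_limit D x.
Proof.
apply: (@cauchy_cvg (completion (pre_gluing D))); apply/cauchyP => e e0.
have e20 : 0 < e / 2 by rewrite divr_gt0.
have [theta pt te] := non_explosive_tree l_non_explosive e20.
have [fin _ cl _] := pt; have tr := plane_tree_root pt.
have [m [_ nxm]] := exit_ray x fin tr.
exists (block_inj (marked (D (mkseq x m)) (x m))).
exists m.+1 => // n /= mn; rewrite ballEmdist /=.
by apply: le_lt_trans (branch_dist_ray cl te nxm mn) _; lra.
Qed.

Lemma branch_dist_limit (theta : set (seq nat)) (e : R) x m :
  (forall u i, theta (rcons u i) -> theta u) ->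
  (forall u, \sum_(k < (size u).+1 | take k u \notin theta) l (take k u) <= e) ->
  ~ theta (mkseq x m.+1) ->
  mdist (block_inj (marked (D (mkseq x m)) (x m))) (ray_limit D x) <= e.
Proof.
move=> cl te nxm; apply/ler_addgt0Pr => d d0.
have [N _ xN] := metricType_numDomainType.cvgr_dist_lt (@ray_limit_cvg x) d0.
have := xN _ (leq_maxl N m.+1); rewrite /= => xd.
have := branch_dist_ray cl te nxm (leq_maxr N m.+1) => me.
apply: (le_trans (metric_triangle _ _ _) (lerD me _)).
by rewrite metric_sym ltW.
Qed.

End branches.

(** * Comparison of the trunks *)

Section trunk.
Context {R : realType} (D D' : decoration R) (theta : set (seq nat)).
Variables (K H : nat) (d : R) (C : forall u, D u -> D' u -> Prop).
Hypothesis theta_parent : forall u i, theta (rcons u i) -> theta u.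
Hypothesis theta_size : forall u, theta u -> (size u <= H)%N.
Hypothesis theta_letter : forall u k, theta u -> (nth 0%N u k < K)%N.
Hypothesis CP : forall u, theta u -> block_corr K d (@C u).

(** The projection to a strict ancestor is the marked point indexed by a letter of [u]; letters of
    trunk words are below [K], so the correspondence preserves this point. *)
Lemma proj_corr u (y : D u) (z : D' u) w : theta u -> C y z -> prefix w u ->
  C (Defs.proj (in_block y) w) (Defs.proj (in_block z) w).
Proof.
move=> tu yz wu; have [wE|/eqP wu'] := eqVneq w u.
  by rewrite wE !proj_self.
rewrite !proj_neq; try by move=> /esym.
have tw := prefix_closed theta_parent wu tu.
by apply: (block_corr_marked (CP tw)); exact: theta_letter.
Qed.

Lemma trunk_distortion_ge0 u (y : D u) (z : D' u) : theta u -> C y z -> 0 <= d.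
Proof.
move=> tu yz; have := block_corr_distortion (CP tu) yz yz.
by rewrite !mdistxx subrr normr0 pmulr_rge0.
Qed.

Lemma height_corr u (y : D u) (z : D' u) w : theta u -> C y z ->
  `|height w (in_block y) - height w (in_block z)| <= 2 * d * H%:R.
Proof.
move=> tu yz; have d0 := trunk_distortion_ge0 tu yz.
rewrite /height /= -sumrB; apply: (le_trans (ler_norm_sum _ _ _)).
apply: (@le_trans _ _ (\sum_((size w).+1 <= k < (size u).+1) 2 * d)).
  apply: ler_sum_nat => k /andP[_ ku].
  have tk := prefix_closed theta_parent (prefix_take u k) tu.
  apply: (block_corr_distortion (CP tk)); first exact: block_corr_root (CP tk).
  exact: proj_corr (prefix_take u k).
rewrite sumr_const_nat -[leLHS]mulr_natr ler_wpM2l ?mulr_ge0 // ler_nat subSS.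
exact: leq_trans (leq_subr _ _) (theta_size tu).
Qed.

(** The gluing distance is one block distance plus two heights of at most [H] terms each, and each
    of these [2 * H + 1] terms is off by at most [2 * d]. *)
Lemma gluing_dist_corr u v (y : D u) (z : D' u) (y' : D v) (z' : D' v) :
  theta u -> theta v -> C y z -> C y' z' ->
  `|gluing_dist (in_block y) (in_block y') -
    gluing_dist (in_block z) (in_block z')| <= 2 * (d * (2 * H + 1)%:R).
Proof.
move=> tu tv yz yz'; rewrite /gluing_dist /=; set w := lcp u v.
have wu : prefix w u := lcp_prefixl _ _.
have wv : prefix w v := lcp_prefixr _ _.
have := height_corr w tu yz; have := height_corr w tv yz'.
have := block_corr_distortion (CP (prefix_closed theta_parent wu tu))
  (proj_corr tu yz wu) (proj_corr tv yz' wv).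
rewrite natrD natrM !ler_norml => /andP[? ?] /andP[? ?] /andP[? ?].
by apply/andP; split; lra.
Qed.

(** Trunk points are related through representatives in a common block. A point with representatives
    in several blocks may occur in several pairs, all covered by the distortion bound. *)
Lemma trunk_amalgam : theta [::] -> 0 < d ->
  exists (Z : pmetricType R) (f : gluing D -> Z) (g : gluing D' -> Z),
    [/\ isometric f, isometric g &
      forall u (y : D u) (z : D' u), theta u -> C y z ->
        mdist (f (block_inj y)) (g (block_inj z)) <= d * (2 * H + 1)%:R].
Proof.
move=> t0 d0; have H0 : 0 < d * (2 * H + 1)%:R by rewrite mulr_gt0 // ltr0n addn1.
pose T (p : gluing D) (q : gluing D') := exists u (y : D u) (z : D' u),
  [/\ theta u, C y z, p = block_inj y & q = block_inj z].
have [|p q p' q'|Z [f [g [fi gi fg]]]] := @correspondence_embedding _ _ _ T _ H0.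
- exists (block_inj (Defs.root (D [::]))), (block_inj (Defs.root (D' [::]))).
  by exists [::], (Defs.root _), (Defs.root _); split => //; exact: block_corr_root (CP t0).
- move=> [u [y [z [tu yz -> ->]]]] [v [y' [z' [tv yz' -> ->]]]].
  by rewrite !block_injE gluing_dist_corr.
exists Z, f, g; split => // u y z tu yz; apply: fg.
by exists u, y, z.
Qed.

End trunk.

(** Only finitely many blocks of the trunk are involved, so their correspondences exist
    simultaneously for large [n]. The parameter [K] lets the caller control further marked points,
    at which branches leave the trunk. *)
Lemma finite_tree_near (R : realType) (D : nat -> decoration R) (Doo : decoration R)
    (theta : set (seq nat)) (K : nat) (e : R) :
  (forall u : seq nat, (fun n => GH_dist_infty (D n u) (Doo u)) @ \oo --> 0%E) ->
  plane_tree theta -> 0 < e ->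
  \forall n \near \oo, exists (Z : pmetricType R)
      (f : gluing (D n) -> Z) (g : gluing Doo -> Z),
    [/\ isometric f, isometric g,
      (forall u (y : D n u), theta u -> exists z : Doo u,
        mdist (f (block_inj y)) (g (block_inj z)) <= e),
      (forall u (z : Doo u), theta u -> exists y : D n u,
        mdist (f (block_inj y)) (g (block_inj z)) <= e) &
      (forall u i, theta u -> (i < K)%N ->
        mdist (f (block_inj (marked (D n u) i))) (g (block_inj (marked (Doo u) i)))
          <= e)].
Proof.
move=> Dcvg pt e0; have t0 := plane_tree_root pt.
have [/finite_seqP[s sE] _ cl _] := pt.
pose H := (\max_(u <- s) size u)%N.
(* The successor puts every letter of [theta] strictly below [K'] and keeps [K'] positive. *)
pose K' := maxn K (\max_(u <- s) \max_(a <- u) a)%N.+1.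
(* Half-distortion [d] per block adds up to radius [e] over paths of depth at most [H]. *)
pose d : R := e / (2 * H + 1)%:R.
have H0 : 0 < (2 * H + 1)%:R :> R by rewrite ltr0n addn1.
have d0 : 0 < d by rewrite divr_gt0.
have near_s : \forall n \near \oo, forall u, u \in s ->
    (GH_dist_pt K' (D n u) (Doo u) < d%:E)%E.
  elim: (s) => [|v r IHr]; first by near=> n.
  near=> n; move=> u; rewrite inE => /orP[/eqP ->|ur].
    near: n; apply: GH_dist_pt_near => //.
    by rewrite /K' leq_max orbT.
  by move: u ur; near: n.
near=> n; have Dn : forall u, u \in s -> (GH_dist_pt K' (D n u) (Doo u) < d%:E)%E.
  by near: n.
(* Outside [theta] an arbitrary relation makes the choice total in [u]. *)
have exC u : exists C : D n u -> Doo u -> Prop, theta u -> block_corr K' d C.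
  have [tu|ntu] := pselect (theta u); last by exists (fun _ _ => True).
  have [|C CP] := @GH_dist_pt_corr _ K' (D n u) (Doo u) d; last by exists C.
  by apply: Dn; rewrite sE in tu.
pose C u := projT1 (cid (exC u)).
have CP u : theta u -> block_corr K' d (C u) by exact: projT2 (cid (exC u)).
have [|u k|Z [f [g [fi gi fg]]]] := @trunk_amalgam _ _ _ theta K' H d C cl _ _ CP t0 d0.
- by move=> u; rewrite sE => us; exact: leq_bigmax_seq.
- rewrite sE => us; rewrite leq_max; apply/orP; right; rewrite ltnS.
  (* Past the end of [u], [nth] returns 0, which obeys the bound too. *)
  have [ku|ku] := ltnP k (size u); last by rewrite nth_default.
  apply: (@leq_trans (\max_(a <- u) a)%N).
    by apply: (@leq_bigmax_seq _ _ xpredT id) => //; exact: mem_nth.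
  exact: (@leq_bigmax_seq _ _ xpredT (fun u : seq nat => \max_(a <- u) a)%N).
have dH : d * (2 * H + 1)%:R = e by rewrite /d mulfVK // gt_eqF.
rewrite dH in fg.
exists Z, f, g; split => //.
- by move=> u y tu; have [z yz] := block_corr_total (CP _ tu) y; exists z; exact: fg.
- by move=> u z tu; have [y yz] := block_corr_surj (CP _ tu) z; exists y; exact: fg.
- move=> u i tu iK; apply: fg => //; apply: (block_corr_marked (CP _ tu)).
  by rewrite leq_max iK.
Unshelve. all: by end_near. Qed.

(** Reaching the trunk costs [2 * e], by density with slack [e], and crossing to the other gluing
    costs [e]. *)
Lemma gluing_hausdorff_le (R : realType) (D D' : decoration R) (l : seq nat -> R)
    (theta : set (seq nat)) (e : R) (Z : pmetricType R)
    (f : gluing D -> Z) (g : gluing D' -> Z) :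
  (forall u (x y : D u), mdist x y <= l u) ->
  (forall u (x y : D' u), mdist x y <= l u) ->
  plane_tree theta -> 0 < e ->
  (forall u, \sum_(k < (size u).+1 | take k u \notin theta) l (take k u) <= e) ->
  isometric f -> isometric g ->
  (forall u (y : D u), theta u -> exists z : D' u,
    mdist (f (block_inj y)) (g (block_inj z)) <= e) ->
  (forall u (z : D' u), theta u -> exists y : D u,
    mdist (f (block_inj y)) (g (block_inj z)) <= e) ->
  (hausdorff_dist (range f) (range g) <= (3 * e)%:E)%E.
Proof.
move=> Dl D'l pt e0 te fi gi fg gf.
have t0 := plane_tree_root pt; have [_ _ cl _] := pt.
apply: hausdorff_dist_le => [_ [p _ <-]|_ [q _ <-]].
  have [u [y [tu py]]] := trunk_dense Dl cl te t0 p e0.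
  have [z yz] := fg u y tu; exists (g (block_inj z)); first by exists (block_inj z).
  apply: (le_trans (metric_triangle _ (f (block_inj y)) _)).
  by rewrite fi; lra.
have [u [z [tu qz]]] := trunk_dense D'l cl te t0 q e0.
have [y yz] := gf u z tu; exists (f (block_inj y)); first by exists (block_inj y).
apply: (le_trans (metric_triangle _ (g (block_inj z)) _)).
by rewrite gi (metric_sym (block_inj z)); lra.
Qed.

Lemma GH_dist_ge0 (R : realType) (X Y : pmetricType R) : (0 <= GH_dist X Y)%E.
Proof.
apply: le_ereal_inf_tmp => _ [Z [f [g [_ _ ->]]]].
exact: hausdorff_dist_ge0.
Qed.

(** * Measures on the Ulam tree *)

(** Finite words are isolated, and a ray outside the cone already differs from [u] within its first
    [size u] letters. *)
Lemma clopen_cone (u : seq nat) : clopen (cone u).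
Proof.
split; first exact: open_cone.
rewrite -openC; apply/ulam_openP => -[w|x] /= nux.
  by exists w; right.
exists (mkseq x (size u)); left; split; first by rewrite /cone /= size_mkseq.
move=> [w|y] /=.
  rewrite !prefixE size_mkseq => /eqP xw /eqP uw; apply: nux.
  by rewrite -xw uw.
by rewrite size_mkseq => xy uy; apply: nux; rewrite -xy uy.
Qed.

Definition cones (F : seq (seq nat)) : set ulam_bar :=
  [set p | exists2 v, v \in F & cone v p].

Lemma clopen_cones F : clopen (cones F).
Proof.
elim: F => [|v F IHF].
  have -> : cones [::] = set0 by apply/seteqP; split => // p [].
  exact: clopen0.
have -> : cones (v :: F) = cone v `|` cones F.
  apply/seteqP; split => [p [w]|p [vp|[w wF wp]]].
  - by rewrite inE => /orP[/eqP -> vp|wF wp]; [left|right; exists w].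
  - by exists v => //; exact: mem_head.
  - by exists w => //; rewrite inE wF orbT.
by apply: clopenU => //; exact: clopen_cone.
Qed.

Lemma open_borel (T : ptopologicalType) (A : set T) : open A ->
  measurable (A : set (borel T)).
Proof. by move=> oA; exact: sub_sigma_algebra. Qed.

Lemma closed_borel (T : ptopologicalType) (A : set T) : closed A ->
  measurable (A : set (borel T)).
Proof.
move=> cA; rewrite -[A]setCK; apply: measurableC; apply: open_borel.
exact: closed_openC.
Qed.

Lemma measurable_words (S : set (seq nat)) :
  measurable (Word @` S : set (borel ulam_bar)).
Proof.
apply: open_borel.
have -> : Word @` S = \bigcup_(u in S) [set Word u].
  by apply/seteqP; split => p; [move=> [u Su <-]; exists u|move=> [u Su ->]; exists u].
by apply: bigcup_open => u _; exact: open_Word.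
Qed.

Lemma ulam_setCW : ~` (range Word) = range Ray.
Proof.
apply/seteqP; split => [[w nw|x _]|_ [x _ <-] [w _ wx]] //.
  by exfalso; apply: nw; exists w.
Qed.

Lemma measurable_rays : measurable (range Ray : set (borel ulam_bar)).
Proof. by rewrite -ulam_setCW; apply: measurableC; exact: measurable_words. Qed.

(** The hypothesis says that [B] is open in the space of rays: it is then the trace on the rays of
    the union of the cones whose rays all lie in [B]. *)
Lemma measurable_ray_set (B : set (nat -> nat)) :
  (forall x, B x -> exists m, forall y, mkseq y m = mkseq x m -> B y) ->
  measurable (Ray @` B : set (borel ulam_bar)).
Proof.
move=> Bm.
have -> : Ray @` B = (\bigcup_(u in [set u | forall y, mkseq y (size u) = u -> B y])
    cone u) `&` range Ray.
  apply/seteqP; split => [_ [x Bx <-]|p [[u uB up] [x _ xE]]]; last first.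
    by exists x => //; apply: uB; rewrite -xE in up.
  split; last by exists x.
  have [m xm] := Bm x Bx; exists (mkseq x m); last by rewrite /cone /= size_mkseq.
  by move=> y; rewrite size_mkseq; exact: xm.
apply: measurableI; last exact: measurable_rays.
by apply: open_borel; apply: bigcup_open => u _; exact: open_cone.
Qed.

Section measure.
Local Open Scope ereal_scope.
Context {R : realType}.

(** Words are countable: [pickle] turns the union over [S] into one indexed by integers, to which
    countable additivity applies. *)
Lemma measure_words (mu : probability (borel ulam_bar) R) (S : set (seq nat)) :
  mu (Word @` S) = \esum_(u in S) mu [set Word u].
Proof.
pose F (k : nat) : set (borel ulam_bar) :=
  if unpickle k is Some u then [set Word (u : seq nat)] else set0.
have FE u : F (pickle u) = [set Word u] by rewrite /F pickleK.
have -> : Word @` S = \bigcup_(k in pickle @` S) F k.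
  rewrite bigcup_image; apply/seteqP; split => p.
    by move=> [u Su <-]; exists u => //; rewrite FE.
  by move=> [u Su]; rewrite FE => ->; exists u.
rewrite measure_bigcup; last first.
- move=> i j [u _ <-] [v _ <-]; rewrite !FE => -[p [-> [->]]] //.
- by move=> _ [u _ <-]; rewrite FE; apply: open_borel; exact: open_Word.
rewrite nneseries_esum //.
rewrite (_ : [set x | x \in pickle @` S] = pickle @` S); last exact: set_mem_set.
rewrite esum_image //; last by move=> u v _ _; exact: (pcan_inj pickleK).
by apply: eq_esum => u _; rewrite FE.
Qed.

(** The indicator of a clopen set is a bounded continuous test function. *)
Lemma weak_cvg_clopen (P : nat -> probability (borel ulam_bar) R)
    (Q : probability (borel ulam_bar) R) (A : set ulam_bar) :
  weak_cvg P Q -> clopen A -> (fun n => P n A) @ \oo --> Q A.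
Proof.
move=> PQ [oA cA].
have mA : measurable (A : set (borel ulam_bar)) by exact: open_borel.
have cont : continuous (\1_A : ulam_bar -> R).
  move=> p; apply/(@cvgrPdist_lt _ _ _ _ (nbhs_filter p)) => d d0.
  rewrite nearE nbhsE.
  have [pA|pA] := pselect (A p).
    by exists A => // q qA /=; rewrite !indicE !mem_set // subrr normr0.
  exists (~` A) => [|q qA /=]; first by split => //; exact: closed_openC.
  by rewrite !indicE !memNset // subrr normr0.
have := PQ _ cont; rewrite integral_indic // setIT.
have -> : (fun n => \int[P n]_x (\1_A x)%:E) = (fun n => P n A).
  by apply/funext => n; rewrite integral_indic // setIT.
by apply; exists 1%R => p; rewrite indicE; case: (p \in A); rewrite ?normr1 ?normr0.
Qed.

Lemma weak_cvg_clopen_near (P : nat -> probability (borel ulam_bar) R)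
    (Q : probability (borel ulam_bar) R) (A : set ulam_bar) (e : R) :
  weak_cvg P Q -> clopen A -> (0 < e)%R ->
  \forall n \near \oo, P n A <= Q A + e%:E /\ Q A <= P n A + e%:E.
Proof.
move=> PQ cA e0; have := weak_cvg_clopen PQ cA.
have mA : measurable (A : set (borel ulam_bar)) by case: cA => /open_borel.
rewrite -[Q A]fineK ?fin_num_measure //.
move=> /fine_cvgP[_ /cvgrPdist_le/(_ e e0)]; apply: filterS => n /=.
rewrite -[P n A]fineK ?fin_num_measure // -!EFinD !lee_fin ler_norml => /andP[? ?].
by split; lra.
Qed.

(** The rank in [n] must be uniform in [S], since the Prokhorov estimate chooses [S] from an
    arbitrary closed set. Only the values of [S] on [F] matter, and they form one of finitely many
    boolean tuples. *)
Lemma weak_cvg_cones (P : nat -> probability (borel ulam_bar) R)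
    (Q : probability (borel ulam_bar) R) (F : seq (seq nat)) (e : R) :
  weak_cvg P Q -> (0 < e)%R ->
  \forall n \near \oo, forall S : pred (seq nat),
    P n (cones [seq v <- F | S v]) <= Q (cones [seq v <- F | S v]) + e%:E /\
    Q (cones [seq v <- F | S v]) <= P n (cones [seq v <- F | S v]) + e%:E.
Proof.
move=> PQ e0; near=> n => S; rewrite filter_mask.
have sz : size (map S F) == size F by rewrite size_map.
rewrite -[map S F]/(tval (Tuple sz)); move: (Tuple sz).
near: n; apply: (@filter_forall _ _ (fun (t : (size F).-tuple bool) n => _)) => t.
by apply: weak_cvg_clopen_near => //; exact: clopen_cones.
Unshelve. all: by end_near. Qed.

(* Every ray leaves the finite tree theta, so the cones of the countably many
   boundary words of theta cover all rays; conclude by continuity from below. *)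
Lemma finite_boundary (Q : probability (borel ulam_bar) R) (theta : set (seq nat))
    (e : R) :
  finite_set theta -> theta [::] -> Q (range Word) = 0 -> (0 < e)%R ->
  exists F : seq (seq nat),
    (forall v, v \in F -> exists w i, [/\ v = rcons w i, theta w & ~ theta v]) /\
    Q (~` cones F) <= e%:E.
Proof.
move=> fin t0 Q0 e0.
pose B := [pred v : seq nat | `[< exists w i, [/\ v = rcons w i, theta w & ~ theta v] >]].
(* The boundary words of code below [m] form finite lists that increase with [m]. *)
pose F m := seq.filter B (pmap (@pickle_inv (seq nat)) (iota 0 m)).
have mF m : measurable (cones (F m) : set (borel ulam_bar)).
  by case: (clopen_cones (F m)) => /open_borel.
have memF m (v : seq nat) : (v \in F m) = B v && (pickle v < m)%N.
  rewrite mem_filter; congr (_ && _); rewrite mem_pmap; apply/mapP/idP.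
    move=> [k]; rewrite mem_iota /= add0n => km /esym kv.
    by have := @pickle_invK (seq nat) k; rewrite kv /= => ->.
  by move=> vm; exists (pickle v); rewrite ?pickleK_inv // mem_iota.
have UF : range Ray `<=` \bigcup_m cones (F m).
  move=> _ [x _ <-]; have [m [xm nxm]] := exit_ray x fin t0.
  exists (pickle (mkseq x m.+1)).+1 => //; exists (mkseq x m.+1).
    rewrite memF ltnSn andbT; apply/asboolP.
    by exists (mkseq x m), (x m); rewrite -mkseqS.
  by rewrite /cone /mkset size_mkseq.
have mU : measurable (\bigcup_m cones (F m) : set (borel ulam_bar)).
  exact: bigcup_measurable.
have QU : Q (\bigcup_m cones (F m)) = 1.
  apply/le_anti; rewrite probability_le1 //=.
  have <- : Q (range Ray) = 1.
    by rewrite -ulam_setCW probability_setC; [rewrite Q0 sube0|exact: measurable_words].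
  by apply: le_measure; rewrite ?inE //; exact: measurable_rays.
have /fine_cvgP[_ /cvgrPdist_le/(_ e e0)[m _ /(_ m (leqnn m)) /= me]] :
    (Q \o (fun m => cones (F m))) @ \oo --> 1.
  rewrite -QU; apply: nondecreasing_cvg_mu => // m n mn.
  apply/subsetPset => p [v vF vp]; exists v => //.
  by move: vF; rewrite !memF => /andP[-> /leq_trans ->].
exists (F m); split.
  by move=> v; rewrite memF => /andP[/asboolP].
rewrite probability_setC // -[Q (cones (F m))]fineK ?fin_num_measure // -EFinB lee_fin.
by move: me; rewrite ler_norml => /andP[].
Qed.

End measure.

(** * Prokhorov distance *)

Section metric_topology.
Context {R : realType}.

Lemma isometric_continuous (X Y : pmetricType R) (f : X -> Y) :
  isometric f -> continuous f.
Proof.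
move=> fi x; apply/metricType_numDomainType.cvgrPdist_lt => e e0.
apply/nbhs_ballP; exists e => // y; rewrite ballEmdist /= => xy.
by rewrite fi.
Qed.

Lemma isometric_closed_preimage (X Y : pmetricType R) (f : X -> Y) (A : set Y) :
  isometric f -> closed A -> closed (f @^-1` A).
Proof.
move=> fi cA; apply: closed_comp => // x _; exact: isometric_continuous.
Qed.

Lemma isometric_open_preimage (X Y : pmetricType R) (f : X -> Y) (A : set Y) :
  isometric f -> open A -> open (f @^-1` A).
Proof. by move=> fi oA; apply: open_comp => // x _; exact: isometric_continuous. Qed.

Lemma open_thickening (Z : pmetricType R) (A : set Z) (e : R) : open (thickening A e).
Proof.
rewrite openE => z [a Aa az]; apply/nbhs_ballP.
exists (e - mdist a z) => /=; first by rewrite subr_gt0.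
move=> t; rewrite ballEmdist /= => zt; exists a => //.
by apply: (le_lt_trans (metric_triangle _ z _)); rewrite -ltrBrDl.
Qed.

End metric_topology.

(** * Block measures compared with measures on words *)

Section gluing_measure.
Context {R : realType} (D : decoration R).
Variables (nu : probability (borel ulam_bar) R)
  (nu_block : forall u, {measure set (borel (D u)) -> \bar R}).
Hypothesis nuE : forall u, nu [set Word u] = nu_block u [set: D u].

Lemma block_inj_isometric u : isometric (@block_inj R D u).
Proof.
move=> x y; rewrite block_injE /gluing_dist /=.
have -> : lcp u u = u by elim: (u) => //= a v ->; rewrite eqxx.
rewrite !proj_self (height_self (in_block x)) (height_self (in_block y)).
by rewrite !addr0.
Qed.

(** Term by term: a block whose word lies in [U] contributes at most its total mass, and any other
    block misses [A]. Closedness of [A] makes its traces on the blocks Borel. *)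
Lemma gluing_measure_le (A : set (gluing D)) (U : set ulam_bar) : closed A ->
  measurable (U : set (borel ulam_bar)) ->
  (forall u (y : D u), A (block_inj y) -> U (Word u)) ->
  (gluing_measure nu_block A <= nu U)%E.
Proof.
move=> cA mU AU; pose S := [set u | U (Word u)].
apply: (@le_trans _ _ (nu (Word @` S))); last first.
  apply: le_measure; rewrite ?inE //; first exact: measurable_words.
  by move=> _ [u uS <-].
rewrite measure_words esum_mkcond; apply: le_esum => u _; rewrite /pushforward.
have mA : measurable (@block_inj _ D u @^-1` A : set (borel (D u))).
  apply: closed_borel; apply: isometric_closed_preimage => //.
  exact: block_inj_isometric.
case: ifPn => [_|/negP uS].
  by rewrite nuE; apply: le_measure; rewrite ?inE //; exact: measurableT.
rewrite (_ : _ @^-1` A = set0) ?measure0 //.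
apply/seteqP; split => // y /= Ay; apply: uS; rewrite inE; exact: AU Ay.
Qed.

(** The rays of [U] carry no mass, and for each word of [U] the whole block lies in [A]. *)
Lemma gluing_measure_ge (A : set (gluing D)) (U : set ulam_bar) :
  measurable (U : set (borel ulam_bar)) -> nu (range Ray) = 0%E ->
  (forall u (y : D u), U (Word u) -> A (block_inj y)) ->
  (nu U <= gluing_measure nu_block A)%E.
Proof.
move=> mU nuR UA; pose S := [set u | U (Word u)].
apply: (@le_trans _ _ (nu (Word @` S `|` range Ray))).
  apply: le_measure; rewrite ?inE //.
    by apply: measurableU; [exact: measurable_words|exact: measurable_rays].
  by move=> [u|x] Up; [left; exists u|right; exists x].
apply: (@le_trans _ _ (nu (Word @` S) + nu (range Ray))%E).
  by apply: measureU2; [exact: measurable_words|exact: measurable_rays].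
rewrite nuR adde0 measure_words esum_mkcond; apply: le_esum => u _.
rewrite /pushforward; case: ifPn => [uS|_]; last exact: measure_ge0.
rewrite nuE (_ : _ @^-1` A = setT) //.
by apply/seteqP; split => // y _; apply: UA; rewrite inE in uS.
Qed.

End gluing_measure.

(** * Image of the boundary measure under [ray_limit] *)

Section ray_measure.
Context {R : realType} (D : decoration R) (l : seq nat -> R).
Hypothesis Dl : forall u (x y : D u), mdist x y <= l u.
Hypothesis l_non_explosive : non_explosive l.

(** This is the continuity of [ray_limit]: two rays that agree until they leave [theta] share the
    marked point at the exit, and both limits are within [e / 3] of it. *)
Lemma ray_limit_open (O : set (gluing D)) (x : nat -> nat) :
  open O -> O (ray_limit D x) ->
  exists m, forall y, mkseq y m = mkseq x m -> O (ray_limit D y).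
Proof.
rewrite openE => oO /oO/nbhs_ballP[e /= e0 eO].
have e30 : 0 < e / 3 by rewrite divr_gt0.
have [theta pt te] := non_explosive_tree l_non_explosive e30.
have [fin _ cl _] := pt; have t0 := plane_tree_root pt.
have [m [xm nxm]] := exit_ray x fin t0.
exists m.+1 => y yx; apply: eO; rewrite ballEmdist /=.
have bx := branch_dist_limit Dl l_non_explosive cl te nxm.
have nym : ~ theta (mkseq y m.+1) by rewrite yx.
have := branch_dist_limit Dl l_non_explosive cl te nym.
move: yx; rewrite !mkseqS => /rcons_inj[-> ->] => by_.
apply: (le_lt_trans (metric_triangle _ _ _)).
rewrite metric_sym in bx.
apply: (le_lt_trans (lerD bx by_)); lra.
Qed.

Lemma measurable_ray_open (O : set (gluing D)) : open O ->
  measurable (Ray @` (ray_limit D @^-1` O) : set (borel ulam_bar)).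
Proof. by move=> oO; apply: measurable_ray_set => x Ox; exact: ray_limit_open. Qed.

Lemma measurable_ray_closed (A : set (gluing D)) : closed A ->
  measurable (Ray @` (ray_limit D @^-1` A) : set (borel ulam_bar)).
Proof.
move=> cA.
have -> : Ray @` (ray_limit D @^-1` A) =
    range Ray `\` Ray @` (ray_limit D @^-1` (~` A)).
  apply/seteqP; split => [_ [x Ax <-]|_ [[x _ <-] nx]].
    by split; [exists x|move=> [y nAy [yx]]; apply: nAy; rewrite yx].
  by exists x => //; apply: contrapT => nAx; apply: nx; exists x.
apply: measurableD; first exact: measurable_rays.
by apply: measurable_ray_open; exact: closed_openC.
Qed.

Variable nu : probability (borel ulam_bar) R.
Hypothesis nuW : nu (range Word) = 0%E.

(** [ray_measure] sees only rays, so the words of [U] are absorbed into [range Word], a null set. *)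
Lemma ray_measure_ge (A : set (gluing D)) (U : set ulam_bar) : open A ->
  measurable (U : set (borel ulam_bar)) ->
  (forall x, U (Ray x) -> A (ray_limit D x)) ->
  (nu U <= ray_measure D nu A)%E.
Proof.
move=> oA mU UA; rewrite /ray_measure.
have mA := measurable_ray_open oA.
apply: (@le_trans _ _ (nu (Ray @` (ray_limit D @^-1` A) `|` range Word))).
  apply: le_measure; rewrite ?inE //.
    by apply: measurableU => //; exact: measurable_words.
  by move=> [u|x] Up; [right; exists u|left; exists x => //; exact: UA].
apply: (le_trans (measureU2 _ _ _)) => //; first exact: measurable_words.
by rewrite [X in (_ + X)%E](_ : _ = 0%E) ?adde0.
Qed.

Lemma ray_measure_le (A : set (gluing D)) (U : set ulam_bar) : closed A ->
  measurable (U : set (borel ulam_bar)) ->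
  (forall x, A (ray_limit D x) -> U (Ray x)) ->
  (ray_measure D nu A <= nu U)%E.
Proof.
move=> cA mU AU; apply: le_measure; rewrite ?inE //.
  exact: measurable_ray_closed.
by move=> _ [x Ax <-]; exact: AU.
Qed.

End ray_measure.

(** * Prokhorov estimate between the two gluings *)

Section prokhorov.
Context {R : realType} (D D' : decoration R) (l : seq nat -> R).
Hypothesis Dl : forall u (x y : D u), mdist x y <= l u.
Hypothesis D'l : forall u (x y : D' u), mdist x y <= l u.
Hypothesis l_non_explosive : non_explosive l.
Variables (theta : set (seq nat)) (e : R) (F : seq (seq nat)).
Hypothesis e0 : 0 < e.
Hypothesis theta_parent : forall u i, theta (rcons u i) -> theta u.
Hypothesis theta_tail : forall u,
  \sum_(k < (size u).+1 | take k u \notin theta) l (take k u) <= e.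
Hypothesis F_boundary : forall v, v \in F ->
  exists w i, [/\ v = rcons w i, theta w & ~ theta v].
Variables (Z : pmetricType R) (f : gluing D -> Z) (g : gluing D' -> Z).
Hypotheses (f_isometric : isometric f) (g_isometric : isometric g).
Hypothesis fg_close : forall w i, rcons w i \in F ->
  mdist (f (block_inj (marked (D w) i))) (g (block_inj (marked (D' w) i))) <= e.

(** Three moves of cost [e]: down the branch to its attachment point, across to the matching marked
    point, and along the ray to its limit. *)
Lemma cone_close v u (y : D u) (x : nat -> nat) : v \in F -> prefix v u ->
  cone v (Ray x) -> mdist (f (block_inj y)) (g (ray_limit D' x)) <= 3 * e.
Proof.
move=> vF; have [w [i [vE tw]]] := F_boundary vF; subst v => ntv wu.
rewrite /cone /mkset size_rcons => xw.
have nxw : ~ theta (mkseq x (size w).+1) by rewrite xw.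
have h1 := branch_dist Dl theta_parent theta_tail y ntv wu.
have h2 := fg_close vF.
have := branch_dist_limit D'l l_non_explosive theta_parent theta_tail nxw.
move: xw; rewrite mkseqS => /rcons_inj[-> ->] h3.
apply: (le_trans (metric_triangle _ (f (block_inj (marked (D w) i))) _)).
rewrite f_isometric (metric_sym (block_inj y)).
have := metric_triangle (f (block_inj (marked (D w) i)))
  (g (block_inj (marked (D' w) i))) (g (ray_limit D' x)).
rewrite g_isometric; lra.
Qed.

Variables (nu nuoo : probability (borel ulam_bar) R)
  (nu_block : forall u, {measure set (borel (D u)) -> \bar R}).
Hypothesis nuE : forall u, nu [set Word u] = nu_block u [set: D u].
Hypothesis nuR : nu (range Ray) = 0%E.
Hypothesis nuooW : nuoo (range Word) = 0%E.
Hypothesis nuooF : (nuoo (~` cones F) <= e%:E)%E.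
Hypothesis nu_cones : forall S : pred (seq nat),
  (nu (cones [seq v <- F | S v]) <= nuoo (cones [seq v <- F | S v]) + e%:E)%E /\
  (nuoo (cones [seq v <- F | S v]) <= nu (cones [seq v <- F | S v]) + e%:E)%E.

Let measurable_cones G : measurable (cones G : set (borel ulam_bar)).
Proof. by apply: open_borel; case: (clopen_cones G). Qed.

Let measurable_conesC G : measurable (~` cones G : set (borel ulam_bar)).
Proof. exact: measurableC. Qed.

(** One [e] is the mass that [nuoo] leaves outside the cones, the other the discrepancy between [nu]
    and [nuoo] on them. *)
Lemma nu_conesC : (nu (~` cones F) <= (2 * e)%:E)%E.
Proof.
have [_] := nu_cones xpredT; rewrite filter_predT.
move: nuooF; rewrite !probability_setC //.
rewrite -[nu (cones F)]fineK ?fin_num_measure //.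
rewrite -[nuoo (cones F)]fineK ?fin_num_measure //.
rewrite -!EFinB -!EFinD !lee_fin => ? ?; lra.
Qed.

Lemma conesU_le (P : probability (borel ulam_bar) R) G :
  (P (cones G `|` ~` cones F) <= P (cones G) + P (~` cones F))%E.
Proof. by apply: measureU2. Qed.

(** A branch of either gluing that meets [A] has its whole counterpart within [3 * e] of [A], so
    [4 * e] satisfies the strict inequality of the thickening. The mass errors are [e + 2 * e] in
    one direction and [e + e] in the other. *)
Lemma prokhorov_dist_gluing_le :
  (@prokhorov_dist R Z
    (@pushforward _ _ (borel (gluing D)) (borel Z) _ (gluing_measure nu_block) f)
    (@pushforward _ _ (borel (gluing D')) (borel Z) _ (ray_measure D' nuoo) g)
    <= (4 * e)%:E)%E.
Proof.
have e_gt0 : 0 < e := e0.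
apply: ereal_inf_lbound; exists (4 * e) => //; split; first by lra.
move=> A cA; rewrite /pushforward; split.
(* G collects the branches that meet A; the part outside the cones of F has
   small mass for both measures. *)
- pose S := [pred v | `[< exists u (y : D u), prefix v u /\ A (f (block_inj y)) >]].
  pose G := [seq v <- F | S v].
  apply: (@le_trans _ _ (nu (cones G `|` ~` cones F))).
    apply: (gluing_measure_le nuE) => //.
    + exact: isometric_closed_preimage.
    + exact: measurableU.
    move=> u y Ay; have [[v vF vu]|nF] := pselect (cones F (Word u)); last by right.
    left; exists v => //; rewrite mem_filter vF andbT; apply/asboolP.
    by exists u, y.
  apply: (le_trans (conesU_le _ _)).
  apply: (@le_trans _ _ (nuoo (cones G) + (4 * e)%:E)%E).
    have [+ _] := nu_cones S => /leeD /(_ nu_conesC) /le_trans; apply.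
    by rewrite -addeA -EFinD leeD2l // lee_fin; lra.
  apply: leeD2r; apply: (ray_measure_ge D'l l_non_explosive nuooW) => //.
  + by apply: isometric_open_preimage => //; exact: open_thickening.
  move=> x [v]; rewrite mem_filter => /andP[/asboolP[u [y [vu Ay]]] vF] vx.
  exists (f (block_inj y)) => //.
  by apply: le_lt_trans (cone_close y vF vu vx) _; lra.
- pose S := [pred v | `[< exists x, cone v (Ray x) /\ A (g (ray_limit D' x)) >]].
  pose G := [seq v <- F | S v].
  apply: (@le_trans _ _ (nuoo (cones G `|` ~` cones F))).
    apply: (ray_measure_le D'l l_non_explosive) => //.
    + exact: isometric_closed_preimage.
    + exact: measurableU.
    move=> x Ax; have [[v vF vx]|nF] := pselect (cones F (Ray x)); last by right.
    left; exists v => //; rewrite mem_filter vF andbT; apply/asboolP.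
    by exists x.
  apply: (le_trans (conesU_le _ _)).
  apply: (@le_trans _ _ (nu (cones G) + (4 * e)%:E)%E).
    have [_ +] := nu_cones S => /leeD /(_ nuooF) /le_trans; apply.
    by rewrite -addeA -EFinD leeD2l // lee_fin; lra.
  apply: leeD2r; apply: (gluing_measure_ge nuE) => //.
  move=> u y [v]; rewrite mem_filter => /andP[/asboolP[x [vx Ax]] vF] vu.
  exists (g (ray_limit D' x)) => //.
  by rewrite metric_sym; apply: le_lt_trans (cone_close y vF vu vx) _; lra.
Qed.

End prokhorov.

(** * Convergence of the gluings *)

Lemma GHP_dist_ge0 (R : realType) (X Y : pmetricType R)
    (mu : set (borel X) -> \bar R) (nu : set (borel Y) -> \bar R) :
  (0 <= GHP_dist mu nu)%E.
Proof.
apply: le_ereal_inf_tmp => _ [Z [f [g [_ _ ->]]]].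
by rewrite le_max hausdorff_dist_ge0.
Qed.

Unset Implicit Arguments.

Theorem theorem3 (R : realType) (D : nat -> decoration R) (Doo : decoration R)
    (D_cvg : forall u : seq nat,
      (fun n => GH_dist_infty (D n u) (Doo u)) @ \oo --> 0%E)
    (D_non_explosive :
      non_explosive (fun u : seq nat => sup (range (fun n => diam (D n u))))) :
  ((fun n => GH_dist (gluing (D n)) (gluing Doo)) @ \oo --> 0%E)
  /\
  (forall (nu_block : forall n (u : seq nat),
             {measure set (borel (D n u)) -> \bar R})
          (nu : nat -> probability (borel ulam_bar) R)
          (nuoo : probability (borel ulam_bar) R),
    (forall n u, nu n [set Word u] = nu_block n u [set: D n u]) ->
    (forall n, nu n (range Ray) = 0%E) ->
    nuoo (range Word) = 0%E ->
    weak_cvg nu nuoo ->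
    (fun n => GHP_dist (gluing_measure (nu_block n)) (ray_measure Doo nuoo))
      @ \oo --> 0%E).
Proof.
pose l (u : seq nat) := sup (range (fun n => diam (D n u))).
have Dl n u (x y : D n u) : mdist x y <= l u := (cvg_sup_diam (D_cvg u)).1 n x y.
have Dool u (x y : Doo u) : mdist x y <= l u := (cvg_sup_diam (D_cvg u)).2 x y.
split.
  apply: cvge0P => [n|e e0]; first exact: GH_dist_ge0.
  have e30 : 0 < e / 3 by rewrite divr_gt0.
  have [theta pt te] := non_explosive_tree D_non_explosive e30.
  (* Without measures, no marked points beyond those used inside the trunk have to be matched. *)
  have := finite_tree_near 0 D_cvg pt e30; apply: filterS => n.
  move=> [Z [f [g [fi gi fg gf _]]]].
  apply: (@le_trans _ _ (hausdorff_dist (range f) (range g))).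
    by apply: ereal_inf_lbound; exists Z, f, g.
  have := gluing_hausdorff_le (Dl n) Dool pt e30 te fi gi fg gf.
  by rewrite mulrC divfK.
move=> nu_block nu nuoo nuE nuR nuooW nu_cvg.
apply: cvge0P => [n|e e0]; first exact: GHP_dist_ge0.
have e40 : 0 < e / 4 by rewrite divr_gt0.
have [theta pt te] := non_explosive_tree D_non_explosive e40.
have [fin _ cl _] := pt; have t0 := plane_tree_root pt.
have [F [FB QF]] := finite_boundary fin t0 nuooW e40.
(* [K] exceeds every letter of the boundary words in [F], so the attachment points of the
   corresponding branches are matched as well. *)
pose K := (\max_(v <- F) \max_(a <- v) a)%N.+1.
near=> n.
have [Z [f [g [fi gi fg gf fgK]]]] : exists (Z : pmetricType R)
      (f : gluing (D n) -> Z) (g : gluing Doo -> Z),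
    [/\ isometric f, isometric g,
      (forall u (y : D n u), theta u -> exists z : Doo u,
        mdist (f (block_inj y)) (g (block_inj z)) <= e / 4),
      (forall u (z : Doo u), theta u -> exists y : D n u,
        mdist (f (block_inj y)) (g (block_inj z)) <= e / 4) &
      (forall u i, theta u -> (i < K)%N ->
        mdist (f (block_inj (marked (D n u) i))) (g (block_inj (marked (Doo u) i)))
          <= e / 4)].
  by near: n; exact: finite_tree_near.
have nu_cones : forall S : pred (seq nat),
    (nu n (cones [seq v <- F | S v]) <= nuoo (cones [seq v <- F | S v]) + (e / 4)%:E)%E /\
    (nuoo (cones [seq v <- F | S v]) <= nu n (cones [seq v <- F | S v]) + (e / 4)%:E)%E.
  by near: n; exact: weak_cvg_cones.
apply: (@le_trans _ _ (maxe (hausdorff_dist (range f) (range g))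
   (@prokhorov_dist R Z
    (@pushforward _ _ (borel (gluing (D n))) (borel Z) _ (gluing_measure (nu_block n)) f)
    (@pushforward _ _ (borel (gluing Doo)) (borel Z) _ (ray_measure Doo nuoo) g)))).
  by apply: ereal_inf_lbound; exists Z, f, g.
rewrite ge_max; apply/andP; split.
  apply: le_trans (gluing_hausdorff_le (Dl n) Dool pt e40 te fi gi fg gf) _.
  by rewrite lee_fin; lra.
have -> : e = 4 * (e / 4) by rewrite mulrC divfK.
apply: (prokhorov_dist_gluing_le (Dl n) Dool D_non_explosive e40 cl te FB fi gi) => //.
move=> w i wF; apply: fgK.
  have [w' [j [/rcons_inj[<- _] tw _]]] := FB _ wF; exact: tw.
rewrite /K ltnS; apply: (@leq_trans (\max_(a <- rcons w i) a)%N).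
  apply: (@leq_bigmax_seq _ _ xpredT id) => //.
  by rewrite mem_rcons mem_head.
exact: (@leq_bigmax_seq _ _ xpredT (fun v : seq nat => \max_(a <- v) a)%N).
Unshelve. all: by end_near. Qed.
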